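(* For complex $q$ with $|q|<1$ the following two identities hold: \[ 7\varphi^3(-q)\varphi^3(-q^7) = -49\Bigl(q^2\frac{E^7(q^7)}{E(q)}+qE^3(q)E^3(q^7)\Bigr) +56\Bigl(7q^4\frac{E^7(q^{14})}{E(q^2)}+q^2E^3(q^2)E^3(q^{14})\Bigr) -\frac{E^7(q)}{E(q^7)}+8\frac{E^7(q^2)}{E(q^{14})}, \] and \[ 56q^3\psi^3(q)\psi^3(q^7) = 49q^2\frac{E^7(q^7)}{E(q)}+7qE^3(q)E^3(q^7) -49\Bigl(q^4\frac{E^7(q^{14})}{E(q^2)}+q^2E^3(q^2)E^3(q^{14})\Bigr) +\frac{E^7(q)}{E(q^7)}-\frac{E^7(q^2)}{E(q^{14})}. \]
   Context: Here $E(q):=\prod_{n=1}^{\infty}(1-q^n)$, $\varphi(q):=\sum_{n=-\infty}^{\infty}q^{n^2}$ and $\psi(q):=\sum_{n=0}^{\infty}q^{n(n+1)/2}$. *)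

(* Defs.v *)
From HB Require Import structures.
From mathcomp Require Import all_boot all_order all_algebra.
From mathcomp Require Import all_classical all_reals all_analysis.
From mathcomp Require Import complex.

Set Implicit Arguments.
Unset Strict Implicit.
Unset Printing Implicit Defensive.

Import Order.TTheory GRing.Theory Num.Theory.
Import numFieldNormedType.Exports.

Local Open Scope classical_set_scope.
Local Open Scope ring_scope.

(* The three functions are defined over any numFieldType K, whose topology is
   that of its norm; K := R[i] with R : realType gives the complex numbers.
   [lim] is total, with a default value on divergent sequences; on the disc
   `|q| < 1 of R[i] all the limits below exist. *)

Definition E (K : numFieldType) (q : K) : K :=
  lim (\prod_(1 <= n < N.+1) (1 - q ^+ n) @[N --> \oo]).

(* A bilateral series is the sum of its two halves, each an ordinary series;
   Negz n is -(n+1), so the second half runs over n <= -1. *)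
Definition bilateral_series (K : numFieldType) (f : int -> K) : K :=
  lim (\sum_(0 <= n < N) f (Posz n) @[N --> \oo]) +
  lim (\sum_(0 <= n < N) f (Negz n) @[N --> \oo]).

Definition phi (K : numFieldType) (q : K) : K :=
  bilateral_series (fun n : int => q ^ (n ^+ 2)).

Definition psi (K : numFieldType) (q : K) : K :=
  lim (\sum_(0 <= n < N) q ^+ (n * n.+1)./2 @[N --> \oo]).

(* Main.v *)
(* Put f = phi(-q) phi(-q^7) and g = q psi(q) psi(q^7).  Gauss's products
   phi(-q) = E(q)^2 / E(q^2) and psi(q) = E(q^2)^2 / E(q) turn q E(q)^3 E(q^7)^3
   and its image under q -> q^2 into f^2 g and f g^2, and counting vectors of
   the form z(q) = sum q^(a^2 + a b + 2 b^2) gives z(q) = f + 4 g and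
   z(q^2) = f + 2 g.  So both identities follow from
     z^3 = E(q)^7 / E(q^7) + 13 q E(q)^3 E(q^7)^3 + 49 q^2 E(q^7)^7 / E(q)
   taken at q and at q^2.

   To prove this cubic, let u = g / f, t = E(q)^4 / (q E(q^7)^4) and
   S = t(q^2) / t(q).  Jacobi's quartic identity for E(q), E(q^2), E(q^4) and its
   image under q -> q^7, combined with z(q^2) = f + 2 g, give
   S + 1/S = 7 + 1/u + 8 u.  The root T of T + 13 + 49/T = (1 + 4 u)^3 / u that is
   rational in u and S then satisfies T(q^2) = S T(q), as t does; hence T / t is
   invariant under q -> q^2, and T = t.

   The argument is carried out for formal power series, where one may cancel
   nonzero factors; the identities are then evaluated at a point of the disc by
   means of polynomial truncations with uniformly bounded l^1 norms. *)
Require Import Defs.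
From HB Require Import structures.
From mathcomp Require Import all_boot all_order all_algebra.
From mathcomp Require Import all_classical all_reals all_analysis.
From mathcomp Require Import complex fraction.
From mathcomp Require Import ring lra zify.

Set Implicit Arguments.
Unset Strict Implicit.
Unset Printing Implicit Defensive.

Import Order.TTheory GRing.Theory Num.Theory.
Import numFieldNormedType.Exports.
Local Open Scope classical_set_scope.
Local Open Scope ring_scope.

(** * Formal power series *)

(** Every relation used here comes out as one factor of a vanishing product: f(q^2) satisfies a
    cubic equation over f and g, and S + 1/S appears through S^3 + S^-3. The unwanted factors are
    discarded because their constant coefficients are nonzero, which is why the work takes place in
    an integral domain of power series. The shape of T comes from its quadratic. With c = (1 + 4
    u)^3 / u - 13 and b = 7 + 1/u + 8 u, the discriminant of T^2 - c T + 49 is c^2 - 196 = (1 - 8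
    u)^2 (b^2 - 4), and b = S + 1/S makes b^2 - 4 the square of S - 1/S. Hence 2 T = c + (1 - 8 u)
    (S - 1/S), where the sign is the one for which T starts with 1/q, as t does. Since u, S and t
    have zeros or poles at q = 0, these computations live in a fraction field; what is stated for
    series has its denominators cleared. *)

Record fps (K : Type) := Fps { fcoef : nat -> K }.

HB.instance Definition _ (K : Type) := gen_eqMixin (fps K).
HB.instance Definition _ (K : Type) := gen_choiceMixin (fps K).

Notation "F .@[ n ]" := (fcoef F n) (at level 2, format "F .@[ n ]").

Lemma fpsP (K : Type) (F G : fps K) : (forall n, F.@[n] = G.@[n]) -> F = G.
Proof. by case: F G => f [g] /= fg; congr Fps; apply/funext. Qed.

Section FpsRing.
Variable K : fieldType.
Implicit Types F G H : fps K.

Definition fps_add F G := Fps (fun n => F.@[n] + G.@[n]).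
Definition fps_opp F := Fps (fun n => - F.@[n]).
Definition fps_zero : fps K := Fps (fun=> 0).
Definition fps_one : fps K := Fps (fun n => (n == 0)%:R).
Definition fps_mul F G := Fps (fun n => \sum_(i < n.+1) F.@[i] * G.@[n - i]).

Fact fps_addA : associative fps_add.
Proof. by move=> F G H; apply: fpsP => n /=; rewrite addrA. Qed.
Fact fps_addC : commutative fps_add.
Proof. by move=> F G; apply: fpsP => n /=; rewrite addrC. Qed.
Fact fps_add0 : left_id fps_zero fps_add.
Proof. by move=> F; apply: fpsP => n /=; rewrite add0r. Qed.
Fact fps_addN : left_inverse fps_zero fps_opp fps_add.
Proof. by move=> F; apply: fpsP => n /=; rewrite addNr. Qed.

HB.instance Definition _ :=
  GRing.isZmodule.Build (fps K) fps_addA fps_addC fps_add0 fps_addN.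

Definition fps_trunc F N : {poly K} := \poly_(i < N) F.@[i].

Lemma coef_fps_trunc F N i : (i < N)%N -> (fps_trunc F N)`_i = F.@[i].
Proof. by move=> iN; rewrite coef_poly iN. Qed.

(** Low coefficients of a product only see truncations, so the ring axioms are inherited from
    polynomials. *)
Lemma fps_mulE F G N n : (n < N)%N ->
  (fps_mul F G).@[n] = (fps_trunc F N * fps_trunc G N)`_n.
Proof.
move=> nN; rewrite coefM; apply: eq_bigr => i _.
by rewrite !coef_fps_trunc//; have := ltn_ord i; lia.
Qed.

Fact fps_mulC : commutative fps_mul.
Proof.
by move=> F G; apply: fpsP => n; rewrite !(fps_mulE _ _ (ltnSn n)) mulrC.
Qed.

Fact fps_mulA : associative fps_mul.
Proof.
move=> F G H; apply: fpsP => n; rewrite !(fps_mulE _ _ (ltnSn n)).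
transitivity ((fps_trunc F n.+1 * (fps_trunc G n.+1 * fps_trunc H n.+1))`_n).
  rewrite !coefM; apply: eq_bigr => i _; congr (_ * _).
  by rewrite coef_fps_trunc ?(@fps_mulE _ _ n.+1) //; have := ltn_ord i; lia.
rewrite mulrA !coefM; apply: eq_bigr => i _; congr (_ * _).
by rewrite coef_fps_trunc ?(@fps_mulE _ _ n.+1) //; have := ltn_ord i; lia.
Qed.

Fact fps_mul1 : left_id fps_one fps_mul.
Proof.
move=> F; apply: fpsP => n /=.
rewrite big_ord_recl /= mul1r subn0 big1 ?addr0 // => i _.
by rewrite mul0r.
Qed.

Fact fps_mulDl : left_distributive fps_mul fps_add.
Proof.
move=> F G H; apply: fpsP => n /=; rewrite -big_split /=.
by apply: eq_bigr => i _; rewrite mulrDl.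
Qed.

Fact fps_one_neq0 : fps_one != fps_zero.
Proof.
by apply/eqP => /(congr1 (fun F => F.@[0])) /= /eqP; rewrite oner_eq0.
Qed.

HB.instance Definition _ := GRing.Zmodule_isComNzRing.Build (fps K)
  fps_mulA fps_mulC fps_mul1 fps_mulDl fps_one_neq0.

Lemma fcoefD F G n : (F + G).@[n] = F.@[n] + G.@[n]. Proof. by []. Qed.
Lemma fcoefN F n : (- F).@[n] = - F.@[n]. Proof. by []. Qed.
Lemma fcoefB F G n : (F - G).@[n] = F.@[n] - G.@[n]. Proof. by []. Qed.
Lemma fcoef1 n : (1 : fps K).@[n] = (n == 0)%:R. Proof. by []. Qed.
Lemma fcoef0 n : (0 : fps K).@[n] = 0. Proof. by []. Qed.
Lemma fcoefM F G n : (F * G).@[n] = \sum_(i < n.+1) F.@[i] * G.@[n - i].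
Proof. by []. Qed.

Lemma fcoefMn F k n : (F *+ k).@[n] = F.@[n] *+ k.
Proof. by elim: k => // k IH; rewrite !mulrSr fcoefD IH. Qed.

Lemma fcoef_sum I (r : seq I) P (F : I -> fps K) n :
  (\sum_(i <- r | P i) F i).@[n] = \sum_(i <- r | P i) (F i).@[n].
Proof. by apply: (big_morph (fun F : fps K => F.@[n])). Qed.

Lemma fcoef0M F G : (F * G).@[0] = F.@[0] * G.@[0].
Proof. by rewrite fcoefM big_ord1. Qed.

Lemma fcoef0X F k : (F ^+ k).@[0] = F.@[0] ^+ k.
Proof. by elim: k => // k IH; rewrite !exprS fcoef0M IH. Qed.

Lemma fps_neq0_coef0 F : F.@[0] != 0 -> F != 0.
Proof. by apply: contra_neq => ->. Qed.

Lemma fps_order F : F != 0 ->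
  exists2 m, F.@[m] != 0 & forall i, (i < m)%N -> F.@[i] = 0.
Proof.
move=> F0; have [n Fn] : exists n, F.@[n] != 0.
  apply/not_existsP => h; case/eqP: F0; apply: fpsP => n.
  by apply/eqP/negP => /negP /h.
pose m := ex_minn (ex_intro (fun n => F.@[n] != 0) n Fn).
exists m; rewrite /m; case: ex_minnP => // k _ kmin i ik.
by apply/eqP/negP => /negP /kmin; rewrite leqNgt ik.
Qed.

Lemma fps_idomain F G : F * G = 0 -> (F == 0) || (G == 0).
Proof.
move=> FG; case: eqVneq => //= F0; case: eqVneq => //= G0.
case: (fps_order F0) => m Fm mF; case: (fps_order G0) => k Gk kG.
have := congr1 (fun F => F.@[m + k]) FG; rewrite fcoefM fcoef0.
have mk : (m < (m + k).+1)%N by lia.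
rewrite (bigD1 (Ordinal mk)) //= addKn big1 ?addr0; last first.
  move=> i /eqP im; have [/mF-> | mi] := ltnP i m; first by rewrite mul0r.
  have {}im : (i : nat) <> m by move=> e; apply: im; apply: val_inj.
  by rewrite kG ?mulr0 //; have := ltn_ord i; lia.
by move/eqP; rewrite mulf_eq0 (negbTE Fm) (negbTE Gk).
Qed.

(** Units are a rung towards [idomainType], over which fractions are formed; inverses are therefore
    simply chosen. *)
Definition fps_unit : {pred fps K} := [pred F | `[< exists G, G * F = 1 >]].
Definition fps_inv F : fps K :=
  if pselect (exists G, G * F = 1) is left e then sval (cid e) else F.

Fact fps_mulVx : {in fps_unit, left_inverse 1 fps_inv *%R}.
Proof.
move=> F /asboolP FU; rewrite /fps_inv; case: pselect => // e.
by case: (cid e).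
Qed.
Fact fps_unitPl F G : G * F = 1 -> F \in fps_unit.
Proof. by move=> FG; apply/asboolP; exists G. Qed.
Fact fps_inv_out : {in [predC fps_unit], fps_inv =1 id}.
Proof.
move=> F /asboolP FU; rewrite /fps_inv.
by case: pselect.
Qed.

HB.instance Definition _ := GRing.ComNzRing_hasMulInverse.Build (fps K)
  fps_mulVx fps_unitPl fps_inv_out.
HB.instance Definition _ := GRing.ComUnitRing_isIntegral.Build (fps K)
  fps_idomain.

End FpsRing.

Section FpsOps.
Variable K : fieldType.
Implicit Types F G H : fps K.

Definition fpsX : fps K := Fps (fun n => (n == 1)%:R).

Lemma fcoefXM F n : (fpsX * F).@[n] = if n is n'.+1 then F.@[n'] else 0.
Proof.
case: n => [|n]; first by rewrite fcoef0M mul0r.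
rewrite fcoefM big_ord_recl mul0r add0r big_ord_recl /= mul1r.
rewrite big1 ?addr0 => [|i _]; last by rewrite mul0r.
by rewrite /bump subSS subn0.
Qed.

Lemma fcoefXnM F k n :
  (fpsX ^+ k * F).@[n] = if (n < k)%N then 0 else F.@[n - k].
Proof.
elim: k n => [|k IH] n; first by rewrite expr0 mul1r subn0.
by rewrite exprS -mulrA fcoefXM; case: n => // n; rewrite IH ltnS subSS.
Qed.

Lemma fcoefXn k n : (fpsX ^+ k).@[n] = (n == k)%:R.
Proof.
rewrite -[_ ^+ k]mulr1 fcoefXnM fcoef1 subn_eq0.
by case: ltngtP.
Qed.

Lemma fpsX_neq0 : fpsX != 0.
Proof. by apply/eqP => /(congr1 (fun F => F.@[1])) /= /eqP; rewrite oner_eq0. Qed.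

(** The substitution q -> q^k. For k = 0 it keeps only the constant coefficient, so it is a ring
    morphism for every k. *)
Definition fps_dil k F : fps K :=
  Fps (fun n => if (k %| n)%N then F.@[n %/ k] else 0).

Lemma fcoef_dil0 k F : (fps_dil k F).@[0] = F.@[0].
Proof. by rewrite /= dvdn0 div0n. Qed.

Lemma fps_trunc_dil k F N : (0 < k)%N ->
  fps_trunc (fps_dil k F) (k * N) = fps_trunc F N \Po 'X^k.
Proof.
move=> k0; apply/polyP => i; rewrite coef_comp_poly_Xn // !coef_poly /=.
case: (boolP (k %| i)%N) => [/dvdnP [j ->]|_]; last by case: ifP.
by rewrite mulnK // mulnC ltn_pmul2l.
Qed.

Fact fps_dil_is_zmod k : zmod_morphism (fps_dil k).
Proof. by move=> F G; apply: fpsP => n /=; case: ifP => //; rewrite subr0. Qed.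

Fact fps_dil_is_monoid k : monoid_morphism (fps_dil k).
Proof.
split=> [|F G]; apply: fpsP => n.
  rewrite /= ; case: k => [|k]; first by rewrite dvd0n divn0; case: n.
  case: dvdnP => [[j ->]|kn]; first by rewrite mulnK // muln_eq0 orbF.
  by case: n kn => // kn; case: kn; exists 0%N.
case: (posnP k) => [->|k0].
  case: n => [|n]; first by rewrite fcoef_dil0 !fcoef0M !fcoef_dil0.
  rewrite [LHS]/= fcoefM big1 // => -[[|i] /= hi] _; last by rewrite mul0r.
  by rewrite mulr0.
have nk : (n < k * n.+1)%N by nia.
rewrite [RHS](fps_mulE _ _ nk) !fps_trunc_dil // -comp_polyM coef_comp_poly_Xn //.
rewrite /=; case: dvdnP => // -[j ->]; rewrite mulnK // -fps_mulE //.
by nia.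
Qed.

HB.instance Definition _ k :=
  GRing.isZmodMorphism.Build _ _ (fps_dil k) (fps_dil_is_zmod k).
HB.instance Definition _ k :=
  GRing.isMonoidMorphism.Build _ _ (fps_dil k) (fps_dil_is_monoid k).

Lemma fps_dilX k : (0 < k)%N -> fps_dil k fpsX = fpsX ^+ k.
Proof.
move=> k0; apply: fpsP => n; rewrite fcoefXn /=.
case: dvdnP => [[j ->]|kn].
  by rewrite mulnK //; congr (_%:R); nia.
by case: eqP => // e; case: kn; exists 1%N; rewrite mul1n.
Qed.

Lemma fps_dilM a b F : (0 < a)%N -> fps_dil a (fps_dil b F) = fps_dil (a * b) F.
Proof.
move=> a0; apply: fpsP => n /=; case: dvdnP => [[j ->]|an].
  by rewrite divnMA !mulnK // [(j * a)%N]mulnC dvdn_pmul2l.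
case: dvdnP => // -[j e]; case: an; exists (j * b)%N; lia.
Qed.

Definition fps_eqmod N F G := forall n, (n < N)%N -> F.@[n] = G.@[n].

Lemma fps_eqmodP F G : (forall N, fps_eqmod N F G) -> F = G.
Proof. by move=> FG; apply: fpsP => n; apply: (FG n.+1). Qed.

Lemma fps_eqmod_refl N F : fps_eqmod N F F. Proof. by []. Qed.

Lemma fps_eqmod_sym N F G : fps_eqmod N F G -> fps_eqmod N G F.
Proof. by move=> h n nN; rewrite h. Qed.

Lemma fps_eqmod_trans N F G H : fps_eqmod N F G -> fps_eqmod N G H ->
  fps_eqmod N F H.
Proof. by move=> h1 h2 n nN; rewrite h1 // h2. Qed.

Lemma fps_eqmodM N F F' G G' : fps_eqmod N F F' -> fps_eqmod N G G' ->
  fps_eqmod N (F * G) (F' * G').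
Proof.
move=> FF GG n nN; apply: eq_bigr => i _.
by rewrite FF ?GG //; have := ltn_ord i; lia.
Qed.

Lemma fps_eqmod_dil N k F G : (0 < k)%N -> fps_eqmod N F G ->
  fps_eqmod N (fps_dil k F) (fps_dil k G).
Proof.
move=> k0 FG n nN /=; case: ifP => // _; apply: FG.
by apply: leq_ltn_trans nN; apply: leq_div.
Qed.

Lemma fps_eqmod_addXn N k F G : (N <= k)%N -> fps_eqmod N (F + fpsX ^+ k * G) F.
Proof.
by move=> Nk n nN; rewrite fcoefD fcoefXnM (leq_trans nN Nk) addr0.
Qed.

(* The dilation by 2 fixes only constants, so a power series is determined by
   the ratio of its dilation to itself. *)
Lemma fps_dil_ratio F G : G.@[0] != 0 -> F.@[0] = G.@[0] ->
  F * fps_dil 2 G = fps_dil 2 F * G -> F = G.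
Proof.
move=> G0 F0 FG; apply/eqP; rewrite -subr_eq0; apply/negPn/negP => D0.
have {FG}: (F - G) * fps_dil 2 G = fps_dil 2 (F - G) * G.
  by rewrite rmorphB /= !mulrBl FG [G * _]mulrC.
have D00 : (F - G).@[0] = 0 by rewrite fcoefB F0 subrr.
move: (F - G) D0 D00 => D /fps_order [m Dm mD] D00.
have m0 : (0 < m)%N by rewrite lt0n; apply: contraNneq Dm => ->; rewrite D00.
(* At the order m > 0 of D the left side has coefficient D_m G_0, while [fps_dil 2 D] only starts at
   2 m > m. *)
move/(congr1 (fun F => F.@[m])); rewrite !fcoefM.
rewrite big_ord_recr big1 ?add0r /=; last first.
  by move=> i _; rewrite mD ?mul0r //=.
rewrite subnn big1; last first.
  move=> i _; rewrite /=; case: ifP => [ie|_]; last by rewrite mul0r.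
  by rewrite mD ?mul0r //; have := ltn_ord i; case/dvdnP: ie => j ->; rewrite mulnK //; lia.
by move/eqP; rewrite add0r dvdn0 div0n mulf_eq0 (negbTE Dm) (negbTE G0).
Qed.

End FpsOps.

(** * Theta series of integer-valued forms *)

(** The bound is an inequality, so that the property passes to any larger form. *)
Definition locally_finite (I : choiceType) (e : I -> int) :=
  forall n : nat, exists2 s : seq I, uniq s & forall i, e i <= n%:Z -> i \in s.

Section Theta.
Variable K : fieldType.

(** The formal sum of w i q^(e i). A coefficient with infinite support defaults to 0, whence the
    hypotheses [locally_finite] below. *)
Definition theta (I : choiceType) (w : I -> K) (e : I -> int) : fps K :=
  Fps (fun n => \sum_(i \in [set i | e i == n%:Z]) w i).

Lemma theta_coef (I : choiceType) (w : I -> K) e (s : seq I) (n : nat) :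
  uniq s -> (forall i, e i = n%:Z -> i \in s) ->
  (theta w e).@[n] = \sum_(i <- s | e i == n%:Z) w i.
Proof.
by move=> us es; rewrite bigfs // => i /eqP /es ->.
Qed.

Lemma locally_finite_pair (I J : choiceType) (e : I -> int) (e' : J -> int) :
  (forall i, 0 <= e i) -> (forall j, 0 <= e' j) ->
  locally_finite e -> locally_finite e' ->
  locally_finite (fun p : I * J => e p.1 + e' p.2).
Proof.
move=> e0 e0' fe fe' n; have [s us es] := fe n; have [t ut et] := fe' n.
exists [seq (i, j) | i <- s, j <- t].
  by apply: allpairs_uniq => // -[? ?] [? ?].
move=> [i j] /= ij; apply/allpairsP; exists (i, j); split => //=.
  by apply: es; have := e0' j; lia.
by apply: et; have := e0 i; lia.
Qed.

Lemma locally_finite_le (I : choiceType) (e e' : I -> int) :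
  (forall i, e i <= e' i) -> locally_finite e -> locally_finite e'.
Proof.
move=> ee fe n; have [s us es] := fe n; exists s => // i ei.
by apply: es; apply: le_trans ei.
Qed.

(** The slack 1 accommodates [tri], which vanishes at -1. *)
Lemma locally_finite_int (e : int -> int) :
  (forall x, `|x| <= e x + 1) -> locally_finite e.
Proof.
move=> ne n; pose s := iota 0 n.+2.
exists (undup (map Posz s ++ map Negz s)); first exact: undup_uniq.
move=> [i|i] ei; rewrite mem_undup mem_cat; apply/orP; [left|right];
  by apply: map_f; rewrite mem_iota; have := le_trans (ne _) (lerD ei (lexx 1)); lia.
Qed.

Lemma eq_theta (I : choiceType) (w w' : I -> K) (e e' : I -> int) :
  w =1 w' -> e =1 e' -> theta w e = theta w' e'.
Proof. by move=> /funext -> /funext ->. Qed.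

Lemma thetaM (I J : choiceType) (w : I -> K) (w' : J -> K) e e' :
  (forall i, 0 <= e i) -> (forall j, 0 <= e' j) ->
  locally_finite e -> locally_finite e' ->
  theta w e * theta w' e' =
  theta (fun p : I * J => w p.1 * w' p.2) (fun p => e p.1 + e' p.2).
Proof.
move=> e0 e0' fe fe'; apply: fpsP => n; rewrite fcoefM.
have [s us es] := fe n; have [t ut et] := fe' n.
rewrite (@theta_coef _ _ _ [seq (i, j) | i <- s, j <- t]); last 2 first.
- by apply: allpairs_uniq => // -[? ?] [? ?].
- move=> [i j] /= ij; apply/allpairsP; exists (i, j); split => //=.
    by apply: es; have := e0' j; lia.
  by apply: et; have := e0 i; lia.
rewrite [RHS]big_mkcond [RHS]big_allpairs.
transitivity (\sum_(k < n.+1) \sum_(x <- s) \sum_(y <- t)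
   (if (e x == k%:Z) && (e' y == (n - k)%N%:Z) then w x * w' y else 0)).
  apply: eq_bigr => k _; have kn := ltn_ord k.
  rewrite (@theta_coef _ _ _ s) //; last by move=> i ei; apply: es; lia.
  rewrite (@theta_coef _ _ _ t) //; last by move=> i ei; apply: et; lia.
  rewrite big_distrlr /= big_mkcond /=; apply: eq_bigr => x _.
  case: eqP => _ /=; last by rewrite big1.
  by rewrite big_mkcond.
rewrite exchange_big /=; apply: eq_bigr => x _.
rewrite exchange_big /=; apply: eq_bigr => y _.
case: eqP => [xy|xy].
  have xn : (absz (e x) < n.+1)%N by have := e0 x; have := e0' y; lia.
  rewrite (bigD1 (Ordinal xn)) //= big1 ?addr0; last first.
    move=> i /eqP ix; case: eqP => //= ei; case: ix; apply: val_inj => /=; lia.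
  by rewrite !ifT //; have := e0 x; have := e0' y; lia.
by rewrite big1 // => i _; case: eqP => //= ei; case: eqP => //= ej; case: xy;
  have := ltn_ord i; lia.
Qed.

Lemma thetaD (I : choiceType) (w w' : I -> K) e : locally_finite e ->
  theta w e + theta w' e = theta (fun i => w i + w' i) e.
Proof.
move=> fe; apply: fpsP => n; rewrite fcoefD.
have [s us es] := fe n.
have {}es i : e i = n%:Z -> i \in s by move=> ei; apply: es; lia.
by rewrite !(theta_coef _ us es) -big_split.
Qed.

Lemma thetaN (I : choiceType) (w : I -> K) e : locally_finite e ->
  - theta w e = theta (fun i => - w i) e.
Proof.
move=> fe; apply: fpsP => n; rewrite fcoefN.
have [s us es] := fe n.
have {}es i : e i = n%:Z -> i \in s by move=> ei; apply: es; lia.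
by rewrite !(theta_coef _ us es) sumrN.
Qed.

Lemma theta_dil (I : choiceType) (w : I -> K) e k : (0 < k)%N ->
  fps_dil k (theta w e) = theta w (fun i => k%:Z * e i).
Proof.
move=> k0; apply: fpsP => n /=; case: dvdnP => [[j ->]|kn].
  rewrite mulnK //; congr (\sum_(i \in _) _); apply/seteqP.
  by split=> i /= /eqP ei; apply/eqP; nia.
rewrite fsbig1 // => i /= /eqP ei; case: kn; exists (absz (e i)).
have e0 : 0 <= e i by nia.
by nia.
Qed.

Lemma theta_X (I : choiceType) (w : I -> K) e k : (forall i, 0 <= e i) ->
  fpsX K ^+ k * theta w e = theta w (fun i => e i + k%:Z).
Proof.
move=> e0; apply: fpsP => n; rewrite fcoefXnM /=; case: ifP => nk.
  by rewrite fsbig1 // => i /= /eqP ei; have := e0 i; lia.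
congr (\sum_(i \in _) _); apply/seteqP.
by split=> i /= /eqP ei; apply/eqP; lia.
Qed.

(** The device behind all lattice arguments below: a weight such as 1 + [sg] vanishes off a
    sublattice, and h parametrizes that sublattice. *)
Lemma theta_reindex (I J : choiceType) (h : I -> J) (w : J -> K) e :
  injective h -> (forall j, (exists i, h i = j) \/ w j = 0) ->
  theta w e = theta (w \o h) (e \o h).
Proof.
move=> hi wh; apply: fpsP => n /=.
rewrite -(@fsbig_image _ _ _ _ _ _ h); last by move=> ? ? _ _ /hi.
symmetry; apply: fsbig_widen => j /=; first by case=> i /= ei <-.
by move=> [ej nj]; case: (wh j) => // -[i hij]; case: nj; exists i; rewrite ?hij.
Qed.

End Theta.

Lemma int_parity (x : int) : (exists k, x = 2 * k) \/ (exists k, x = 2 * k + 1).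
Proof.
have := divz_eq x 2; have := ltz_pmod x (isT : 0 < 2 :> int).
have := modz_ge0 x (isT : 2 != 0 :> int).
set k := (x %/ 2)%Z; set r := (x %% 2)%Z => r0 r1 xE.
have [re|re] : r = 0 \/ r = 1 by lia.
  by left; exists k; lia.
by right; exists k; lia.
Qed.

Definition tri (x : int) : int := ((x * (x + 1)) %/ 2)%Z.

Lemma triE x : 2 * tri x = x * (x + 1).
Proof.
suff [k xk] : exists k, x * (x + 1) = k * 2.
  by rewrite /tri xk mulzK // mulrC.
have [|] := int_parity x => -[k ->]; first by exists (k * (2 * k + 1)); ring.
by exists ((2 * k + 1) * (k + 1)); ring.
Qed.

Lemma tri_ge0 x : 0 <= tri x. Proof. by have := triE x; nia. Qed.

Lemma sqr_locally_finite : locally_finite (fun x : int => x * x).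
Proof. by apply: locally_finite_int => x; nia. Qed.

Lemma tri_locally_finite : locally_finite tri.
Proof. by apply: locally_finite_int => x; have := triE x; nia. Qed.

Lemma locally_finiteZ (I : choiceType) (e : I -> int) (k : int) : 0 < k ->
  (forall i, 0 <= e i) -> locally_finite e -> locally_finite (fun i => k * e i).
Proof. by move=> k0 e0; apply: locally_finite_le => i; have := e0 i; nia. Qed.

(** * Quadratic relations between the classical theta series *)

Section ThetaIdentities.
Variable K : numFieldType.

Definition sg (x : int) : K := (-1) ^ x.

Lemma sgD x y : sg (x + y) = sg x * sg y.
Proof. by rewrite /sg expfzDr // oppr_eq0 oner_eq0. Qed.

Lemma sg_double x : sg (2 * x) = 1.
Proof. by rewrite /sg -exprz_exp -exprnP sqrrN expr1n exp1rz. Qed.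

Lemma sg1 : sg 1 = -1. Proof. by []. Qed.

Lemma sg_even x : (exists k, x = 2 * k) \/ sg x = -1.
Proof.
have [xk|] := int_parity x; [by left | move=> [k ->]].
by right; rewrite sgD sg_double mul1r.
Qed.

Lemma sg_odd x : (exists k, x = 2 * k + 1) \/ sg x = 1.
Proof.
have [[k xk]|sx] := sg_even (x - 1).
  by left; exists k; lia.
by right; rewrite -(subrK 1 x) sgD sx mulrN1 opprK.
Qed.

Lemma sgN x : sg (- x) = sg x.
Proof.
have -> : - x = x + 2 * (- x) by ring.
by rewrite sgD sg_double mulr1.
Qed.

Lemma sgB x y : sg (x - y) = sg x * sg y.
Proof. by rewrite sgD sgN. Qed.

Lemma sg_sq x : sg x * sg x = 1.
Proof. by rewrite -sgD -mulr2n -mulr_natl sg_double. Qed.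

Definition phiS : fps K := theta (fun=> 1) (fun x : int => x * x).
Definition phiMS : fps K := theta sg (fun x : int => x * x).
Definition psiS : fps K := theta (fun=> 1) (fun n : nat => tri n).

(** n and -1 - n have the same triangular number. *)
Lemma double_psiS : 2 * psiS = theta (fun=> 1) tri.
Proof.
rewrite (@eq_theta K _ _ (fun x : int => (0 <= x)%R%:R + (x < 0)%R%:R) _ tri) //;
  last by move=> x; case: lerP; rewrite ?addr0 ?add0r.
rewrite -thetaD; last exact: tri_locally_finite.
rewrite mulr_natl mulr2n; congr (_ + _).
  rewrite [RHS](theta_reindex (h := Posz)); first by [].
    by move=> ? ? [].
  by case=> n /=; [left; exists n | right].
rewrite [RHS](theta_reindex (h := Negz)); last 2 first.
- by move=> ? ? [].
- by case=> n /=; [right | left; exists n].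
apply: eq_theta => n //=; have := triE n; have := triE (Negz n).
by rewrite NegzE; lia.
Qed.

Notation sq := (fun x : int => x * x).

Lemma theta_sq_pair (w w' : int -> K) :
  theta w sq * theta w' sq =
  theta (fun p : int * int => w p.1 * w' p.2) (fun p => p.1 * p.1 + p.2 * p.2).
Proof. by apply: thetaM => *; [nia|nia|apply: sqr_locally_finite..]. Qed.

Definition sumsq (p : int * int) : int := p.1 * p.1 + p.2 * p.2.

Lemma sumsq_locally_finite : locally_finite sumsq.
Proof.
by apply: (@locally_finite_pair _ _ sq sq) => *;
  [nia|nia|apply: sqr_locally_finite..].
Qed.

(* The sublattice x + y even is a copy of Z^2 with the form doubled. *)
Lemma theta_even_sumsq (w : int * int -> K) :
  theta (fun p => (1 + sg (p.1 + p.2)) * w p) sumsq =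
  2 * fps_dil 2 (theta (fun p => w (p.1 + p.2, p.1 - p.2)) sumsq).
Proof.
rewrite (theta_reindex (h := fun p : int * int => (p.1 + p.2, p.1 - p.2))).
- rewrite theta_dil // mulr_natl mulr2n thetaD; last first.
    apply: locally_finiteZ => // [p|]; first by rewrite /sumsq; nia.
    exact: sumsq_locally_finite.
  apply: eq_theta => -[x y] /=; last by rewrite /sumsq /=; ring.
  have -> : x + y + (x - y) = 2 * x by ring.
  by rewrite sg_double; ring.
- by move=> [x y] [x' y'] [] *; congr (_, _); lia.
move=> [x y] /=; have [[k xk]|->] := sg_even (x + y); last first.
  by right; rewrite subrr mul0r.
by left; exists (k, x - k) => /=; congr (_, _); lia.
Qed.

Lemma phiS_sq_add : phiS ^+ 2 + phiMS ^+ 2 = 2 * fps_dil 2 phiS ^+ 2.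
Proof.
rewrite -rmorphXn /= !expr2 /phiS /phiMS !theta_sq_pair thetaD; last first.
  exact: sumsq_locally_finite.
rewrite [in RHS](_ : theta _ _ = theta (fun=> 1) sumsq); last first.
  by apply: eq_theta => // p; rewrite mulr1.
rewrite -(theta_even_sumsq (fun=> 1)); apply: eq_theta => // p /=.
by rewrite sgD !mulr1.
Qed.

(** Exchanging x and y replaces the weight (-1)^y by half of (-1)^x + (-1)^y = (1 + (-1)^(x + y))
    (-1)^y, which lives on the sublattice x + y even. *)
Lemma phiS_mul_phiMS : phiS * phiMS = fps_dil 2 phiMS ^+ 2.
Proof.
rewrite -rmorphXn /= expr2 /phiS /phiMS !theta_sq_pair -/sumsq.
have n2 : (2 : fps K) != 0.
  by apply: fps_neq0_coef0; rewrite fcoefMn fcoef1 pnatr_eq0.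
apply: (mulfI n2).
rewrite [in RHS](_ : theta _ _ = theta (fun p : int * int =>
   (fun q => sg q.2) (p.1 + p.2, p.1 - p.2)) sumsq); last first.
  by apply: eq_theta => // p; rewrite sgB.
rewrite -(theta_even_sumsq (fun q => sg q.2)) mulr_natl mulr2n.
rewrite -[X in X + _](_ : theta (fun p => sg p.1) sumsq = _); last first.
  rewrite (theta_reindex (h := fun p : int * int => (p.2, p.1))).
  - by apply: eq_theta => -[x y] /=; rewrite ?mul1r // /sumsq /=; ring.
  - by move=> [? ?] [? ?] [] -> ->.
  - by move=> [x y]; left; exists (y, x).
rewrite thetaD; last exact: sumsq_locally_finite.
apply: eq_theta => // -[x y] /=.
by rewrite sgD mulrDl -mulrA sg_sq mulr1 mul1r addrC.
Qed.

(** For x + y odd put x = a + b + 1, y = a - b; then x^2 + y^2 = 4 (tri a + tri b) + 1. In the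
    constant 8, a factor 2 is the weight 1 - (-1)^(x + y) and a factor 4 comes from the two doubled
    series [psiS]. *)
Lemma phiS_sq_sub :
  phiS ^+ 2 - phiMS ^+ 2 = 8 * fpsX K * fps_dil 4 psiS ^+ 2.
Proof.
have -> : 8 * fpsX K * fps_dil 4 psiS ^+ 2 =
          2 * (fpsX K ^+ 1 * fps_dil 4 (2 * psiS) ^+ 2).
  by rewrite rmorphM /= rmorph_nat; ring.
rewrite double_psiS -rmorphXn /= !expr2 /phiS /phiMS !theta_sq_pair.
rewrite thetaN; last exact: sumsq_locally_finite.
rewrite thetaD; last exact: sumsq_locally_finite.
rewrite thetaM; try by [exact: tri_ge0 | exact: tri_locally_finite].
rewrite (theta_reindex (h := fun p : int * int => (p.1 + p.2 + 1, p.1 - p.2))).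
- rewrite theta_dil // theta_X; last first.
    by move=> p; have := tri_ge0 p.1; have := tri_ge0 p.2; lia.
  rewrite mulr_natl mulr2n thetaD; last first.
    apply: (@locally_finite_le _ (fun p => tri p.1 + tri p.2)).
      by move=> p; have := tri_ge0 p.1; have := tri_ge0 p.2; lia.
    by apply: locally_finite_pair;
      try by [exact: tri_ge0 | exact: tri_locally_finite].
  apply: eq_theta => -[x y] /=; last first.
    by have := triE x; have := triE y; lia.
  have -> : sg (x + y + 1) * sg (x - y) = -1.
    by rewrite -sgD (_ : _ + _ = 2 * x + 1) ?sgD ?sg_double ?mul1r //; ring.
  by rewrite !mulr1 opprK.
- by move=> [x y] [x' y'] [] *; congr (_, _); lia.
move=> [x y] /=; have [[k xk]|s1] := sg_odd (x + y); last first.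
  by right; rewrite -sgD s1 mulr1 subrr.
by left; exists (k, x - k - 1) => /=; congr (_, _); lia.
Qed.

End ThetaIdentities.

(** * Theta series of the form of discriminant -7 *)

Section LevelSeven.
Variable K : numFieldType.

Local Notation sg := (@sg K).
Local Notation X := (fpsX K).
Local Notation dil := fps_dil.

Definition qform (p : int * int) : int :=
  p.1 * p.1 + p.1 * p.2 + 2 * (p.2 * p.2).

Lemma qform_ge0 p : 0 <= qform p. Proof. by rewrite /qform; nia. Qed.

Lemma qform_locally_finite : locally_finite qform.
Proof.
move=> n; have [s us sP] := @sumsq_locally_finite (2 * n)%N.
by exists s => // p pn; apply: sP; move: pn; rewrite /qform /sumsq; nia.
Qed.

Definition qformS : fps K := theta (fun=> 1) qform.

Definition phi2S : fps K := phiMS K * dil 7 (phiMS K).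
Definition psi2S : fps K := X * psiS K * dil 7 (psiS K).

Lemma natr_fps_neq0 n : (n.+1%:R : fps K) != 0.
Proof. by apply: fps_neq0_coef0; rewrite fcoefMn fcoef1 pnatr_eq0. Qed.

(** On vectors with even first coordinate the form is twice itself: qform (2 b, a) = 2 qform (a,
    b). *)
Lemma theta_even_qform :
  theta (fun p => 1 + sg p.1) qform = 2 * dil 2 qformS.
Proof.
rewrite (theta_reindex (h := fun p : int * int => (2 * p.2, p.1))).
- rewrite theta_dil // mulr_natl [RHS]mulr2n thetaD; last first.
    apply: locally_finiteZ => //; first exact: qform_ge0.
    exact: qform_locally_finite.
  apply: eq_theta => -[x y] /=; first by rewrite sg_double.
  by rewrite /qform /=; ring.
- by move=> [x y] [x' y'] [] *; congr (_, _); lia.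
move=> [x y] /=; have [[k ->]|->] := sg_even K x; last by right; rewrite subrr.
by left; exists (y, k).
Qed.

(* 4 g is the sum of q^((x^2 + 7 y^2) / 8) over odd x, y; changing the sign of y
   one may assume x = y + 4 k, and then (x^2 + 7 y^2) / 8 = y^2 + y k + 2 k^2. *)
Lemma theta_odd_qform :
  theta (fun p => 1 - sg p.1) qform = 4 * psi2S.
Proof.
apply: (mulfI (natr_fps_neq0 1)).
have -> : 2 * (4 * psi2S) = 2 * (X ^+ 1 * ((2 * psiS K) * dil 7 (2 * psiS K))).
  by rewrite rmorphM /= rmorph_nat /psi2S; ring.
rewrite double_psiS theta_dil // thetaM; last 4 first.
- exact: tri_ge0.
- by move=> j; have := tri_ge0 j; lia.
- exact: tri_locally_finite.
- by apply: locally_finiteZ => //; [exact: tri_ge0 | exact: tri_locally_finite].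
pose e (p : int * int) := tri p.1 + 7 * tri p.2 + 1.
have fe : locally_finite e.
  apply: (@locally_finite_le _ (fun p => tri p.1 + tri p.2)).
    by move=> [x y]; rewrite /e /=; have := tri_ge0 x; have := tri_ge0 y; lia.
  by apply: locally_finite_pair;
    try by [exact: tri_ge0 | exact: tri_locally_finite].
rewrite theta_X; last first.
  by move=> [x y] /=; have := tri_ge0 x; have := tri_ge0 y; lia.
rewrite [in RHS](@eq_theta _ _ _ (fun=> 1) _ e); last 2 first.
- by move=> p /=; rewrite mulr1.
- by [].
(* The odd coordinates being 2 x + 1 and 2 y + 1, the sign change is y -> -1 - y. It fixes [e] and
   reverses the parity of x + y, so the series with weight [sg (x + y)] vanishes. *)
have -> : 2 * theta (fun=> 1) e =
  2 * theta (fun p : int * int => 1 + sg (p.1 + p.2)) e :> fps K.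
  rewrite !mulr_natl !mulr2n.
  rewrite -(thetaD (fun=> 1) (fun p => sg (p.1 + p.2)) fe) addrACA.
  rewrite -[LHS]addr0; congr (_ + _).
  apply/esym/eqP; rewrite addr_eq0; apply/eqP.
  rewrite [LHS](theta_reindex (h := fun p : int * int => (p.1, - 1 - p.2))).
  - rewrite thetaN //; apply: eq_theta => -[x y] /=.
      by rewrite !sgD !sgN /sg expr1z; ring.
    by have := triE y; have := triE (- 1 - y); rewrite /e /=; lia.
  - by move=> [x y] [x' y'] [] *; congr (_, _); lia.
  - by move=> [x y]; left; exists (x, - 1 - y) => /=; congr (_, _); lia.
rewrite !mulr_natl; congr (_ *+ 2).
rewrite [LHS](theta_reindex (h := fun p : int * int => (2 * p.1 + 1, p.2))); last 2 first.
- by move=> [x y] [x' y'] [] *; congr (_, _); lia.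
- move=> [x y] /=; have [[k ->]|->] := sg_odd K x; last by right; rewrite subrr.
  by left; exists (k, y).
rewrite [RHS](theta_reindex (h := fun p : int * int => (p.1 + 2 * p.2, p.1))); last 2 first.
- by move=> [x y] [x' y'] [] *; congr (_, _); lia.
- move=> [x y] /=; have [[k xk]|->] := sg_even K (x + y); last by right; rewrite subrr.
  by left; exists (y, k - y) => /=; congr (_, _); lia.
apply: eq_theta => -[x y] /=.
  have -> : x + 2 * y + x = 2 * (x + y) by ring.
  by rewrite !sgD !mulrDr !sgD !sg_double sg1; ring.
by have := triE x; have := triE (x + 2 * y); rewrite /e /qform /=; lia.
Qed.

(** x^2 + 7 y^2 = qform (x - y, 2 y): the form lives on the vectors with even second coordinate, and
    (-1)^(x + y) is the sign of the first coordinate. *)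
Lemma phi2S_qform :
  phi2S = theta (fun p : int * int => sg p.1 * (1 + sg p.2) / 2) qform.
Proof.
rewrite /phi2S theta_dil // thetaM; last 4 first.
- by move=> x; nia.
- by move=> x; nia.
- exact: sqr_locally_finite.
- by apply: locally_finiteZ => // [x|]; [nia | exact: sqr_locally_finite].
rewrite [RHS](theta_reindex (h := fun p : int * int => (p.1 - p.2, 2 * p.2))); last 2 first.
- by move=> [x y] [x' y'] [] *; congr (_, _); lia.
- move=> [x y] /=; have [[k ->]|->] := sg_even K y.
    by left; exists (x + k, k) => /=; congr (_, _); lia.
  by right; rewrite subrr mulr0 mul0r.
apply: eq_theta => -[x y] /=; last by rewrite /qform /=; ring.
by rewrite sg_double sgB mulfK // -[1 + 1]/(2%:R) pnatr_eq0.
Qed.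

(* For b odd the isometry (a, b) -> (- a - b, b) changes the parity of a. *)
Lemma theta_qform_cancel :
  theta (fun p : int * int => sg p.1 * (1 - sg p.2)) qform = 0.
Proof.
apply: (mulfI (natr_fps_neq0 1)); rewrite mulr0 mulr_natl mulr2n.
apply/eqP; rewrite addr_eq0; apply/eqP.
rewrite thetaN; last exact: qform_locally_finite.
rewrite [LHS](theta_reindex (h := fun p : int * int => (- p.1 - p.2, p.2))); last 2 first.
- by move=> [x y] [x' y'] [] *; congr (_, _); lia.
- by move=> [x y]; left; exists (- x - y, y) => /=; congr (_, _); lia.
apply: eq_theta => -[x y] /=; last by rewrite /qform /=; ring.
rewrite sgB sgN; have := sg_sq K y.
by move=> ys; ring: ys.
Qed.

Lemma qformS_sub : qformS - dil 2 qformS = 2 * psi2S.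
Proof.
apply: (mulfI (natr_fps_neq0 1)).
rewrite mulrBr -theta_even_qform mulrA -natrM -theta_odd_qform mulr_natl mulr2n.
rewrite /qformS thetaN; last exact: qform_locally_finite.
do 2 (rewrite thetaD; last exact: qform_locally_finite).
by apply: eq_theta => // p; ring.
Qed.

(** By [theta_qform_cancel] odd second coordinates contribute nothing under the weight (-1)^a, so
    [phi2S] has that weight on the whole lattice; 1 + (-1)^a then selects the sublattice of
    [theta_even_qform]. *)
Lemma qformS_add : phi2S + qformS = 2 * dil 2 qformS.
Proof.
apply: (mulfI (natr_fps_neq0 1)).
rewrite -theta_even_qform phi2S_qform -[LHS]addr0 -theta_qform_cancel.
rewrite /qformS !mulr_natl !mulr2n.
do 4 (rewrite thetaD; last exact: qform_locally_finite).
apply: eq_theta => // p.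
by field.
Qed.

End LevelSeven.

(** * Gauss's product formulas *)

Section FiniteGauss.
Variable (R : comNzRingType) (q : R).

(** A finite form of Gauss's identity in the manner of Shanks, written without division. On the
    right the term s = 0 is the Euler product up to n, and all others are divisible by q^(n+1). *)
Lemma gauss_phi_finite n :
  \prod_(1 <= k < n.+1) (1 + q ^+ k) *
    (2 * (\sum_(0 <= s < n.+1) (-1) ^+ s * q ^+ (s * s)) - 1) =
  \sum_(0 <= s < n.+1) (-1) ^+ s * q ^+ (s * n.+1) *
    \prod_(0 <= k < s) (1 + q ^+ k) * \prod_(s.+1 <= k < n.+1) (1 - q ^+ k).
Proof.
pose A s := \prod_(0 <= k < s) (1 + q ^+ k).
pose T n s := (-1) ^+ s * q ^+ (s * n.+1) * A s *
   \prod_(s.+1 <= k < n.+1) (1 - q ^+ k).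
have AS s : A s.+1 = A s * (1 + q ^+ s) by rewrite /A big_nat_recr.
have A2 s : A s.+1 = 2 * \prod_(1 <= k < s.+1) (1 + q ^+ k).
  by rewrite /A big_ltn // expr0.
(* T n.+1 s - (1 + q ^+ n.+1) * T n s = G n s.+1 - G n s, and G n 0 = 0. *)
pose G n s := (-1) ^+ s * q ^+ (s * n.+1) * A s *
   \prod_(s <= k < n.+1) (1 - q ^+ k).
have tele n' m : (m <= n'.+1)%N ->
  \sum_(0 <= s < m) T n'.+1 s =
    (1 + q ^+ n'.+1) * \sum_(0 <= s < m) T n' s + G n' m.
  elim: m => [|m IH] mn.
    by rewrite !big_geq // /G big_ltn // expr0 subrr mul0r !mulr0 addr0.
  rewrite !big_nat_recr //= IH ?(ltnW mn) // mulrDr -!addrA; congr (_ + _).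
  have -> : T n'.+1 m = T n' m * (q ^+ m * (1 - q ^+ n'.+1)).
    rewrite /T big_nat_recr //= mulnS [(m + _)%N]addnC exprD; ring.
  have GE : G n' m = T n' m * (1 - q ^+ m) by rewrite /G /T big_ltn //; ring.
  rewrite GE /G /T AS mulSn exprD exprSr exprS; ring.
elim: n => [|n IH].
  by rewrite !big_nat1 !big_geq // !mulr1 expr0 !mul1r; ring.
rewrite -[RHS]/(\sum_(0 <= s < n.+2) T n.+1 s).
rewrite [RHS]big_nat_recr //= tele // -[\sum_(0 <= s < n.+1) T n s]IH.
rewrite (@big_nat_recr _ _ _ n.+1 1) // (@big_nat_recr _ _ _ n.+1 0) //=.
rewrite /G /T (@big_geq _ _ _ n.+1 n.+1) // (@big_geq _ _ _ n.+2 n.+2) // !A2.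
have -> : (n.+1 * n.+2 = n.+1 * n.+1 + n.+1)%N by lia.
by rewrite exprD exprS; ring.
Qed.

(** The companion for triangular exponents: the term s = 0 is the product of the even factors, and
    the others are divisible by q^(2n+1). *)
Lemma gauss_psi_finite n :
  \sum_(0 <= s < n) q ^+ (s * n.*2.+1) *
    \prod_(1 <= k < s.+1) (1 - q ^+ k.*2.-1) *
    \prod_(s.+1 <= k < n.+1) (1 - q ^+ k.*2) =
  \prod_(1 <= k < n.+1) (1 - q ^+ k.*2.-1) *
    \sum_(0 <= j < n.*2) q ^+ 'C(j.+1, 2).
Proof.
pose A s := \prod_(1 <= k < s.+1) (1 - q ^+ k.*2.-1).
pose T n s := q ^+ (s * n.*2.+1) * A s *
   \prod_(s.+1 <= k < n.+1) (1 - q ^+ k.*2).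
have AS s : A s.+1 = A s * (1 - q ^+ s.*2.+1) by rewrite /A big_nat_recr.
(* T n.+1 s - (1 - q ^+ n.*2.+1) * T n s = G n s.+1 - G n s. *)
pose G n s := q ^+ (s * n.*2.+1) * A s * \prod_(s <= k < n.+1) (1 - q ^+ k.*2).
have tele n' m : (m <= n'.+1)%N ->
  \sum_(0 <= s < m) T n'.+1 s =
    (1 - q ^+ n'.*2.+1) * \sum_(0 <= s < m) T n' s + G n' m.
  elim: m => [|m IH] mn.
    by rewrite !big_geq // /G big_ltn // expr0 subrr mul0r !mulr0 addr0.
  rewrite !big_nat_recr //= IH ?(ltnW mn) // mulrDr -!addrA; congr (_ + _).
  have -> : T n'.+1 m = T n' m * (q ^+ m.*2 * (1 - q ^+ n'.+1.*2)).
    rewrite /T big_nat_recr //=.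
    have -> : (m * n'.+1.*2.+1 = m * n'.*2.+1 + m.*2)%N by nia.
    rewrite exprD; ring.
  have GE : G n' m = T n' m * (1 - q ^+ m.*2) by rewrite /G /T big_ltn //; ring.
  rewrite GE /G /T AS mulSn exprD doubleS !exprS; ring.
elim: n => [|n IH]; first by rewrite !big_geq // mulr0.
rewrite -[LHS]/(\sum_(0 <= s < n.+1) T n.+1 s).
rewrite [LHS]big_nat_recr //= tele ?leqnSn // [X in _ * X + _ + _]IH.
rewrite doubleS (@big_nat_recr _ _ _ n.*2.+1 0) // (@big_nat_recr _ _ _ n.*2 0) //.
rewrite (@big_nat_recr _ _ _ n.+1 1) //= /G /T !big_nat1 /A.
have -> : 'C(n.*2.+1, 2) = (n * n.*2.+1)%N.
  by rewrite bin2 /= mulnC -doubleMl doubleK.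
have -> : 'C(n.*2.+2, 2) = (n.+1 * n.*2.+1)%N.
  by rewrite bin2 -[X in (X * _)./2]/(n.+1.*2) -doubleMl doubleK.
have -> : (n * (n.+1).*2.+1 = n * n.*2.+1 + n.*2)%N by nia.
rewrite mulSn !exprD !exprS; ring.
Qed.

End FiniteGauss.

Section Gauss.
Variable K : numFieldType.
Local Notation X := (fpsX K).
Local Notation dil := fps_dil.

Definition eulerP N : fps K := \prod_(1 <= k < N.+1) (1 - X ^+ k).
(** Factors beyond k = n leave the coefficient of X^n unchanged, so it is read off the n-th partial
    product. *)
Definition eulerS : fps K := Fps (fun n => (eulerP n).@[n]).

Lemma fps_eqmod_eulerP N : fps_eqmod N.+1 eulerS (eulerP N).
Proof.
move=> n; rewrite ltnS; elim: N => [|N IH].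
  by rewrite leqn0 => /eqP ->.
rewrite leq_eqVlt => /predU1P [->|] //.
rewrite ltnS => nN; rewrite IH //.
have -> : eulerP N.+1 = eulerP N + X ^+ N.+1 * - eulerP N.
  by rewrite /eulerP [LHS]big_nat_recr //=; ring.
by rewrite (@fps_eqmod_addXn _ N.+1).
Qed.

Lemma eulerS_coef0 : eulerS.@[0] = 1.
Proof. by rewrite /= /eulerP big_geq. Qed.

Lemma phiMS_eqmod N : fps_eqmod N.+1 (phiMS K)
  (2 * (\sum_(0 <= s < N.+1) (-1) ^+ s * X ^+ (s * s)) - 1).
Proof.
move=> n nN; rewrite /phiMS.
rewrite (@theta_coef _ _ _ _ (map Posz (iota 0 N.+1) ++ map Negz (iota 0 N))); last 2 first.
- rewrite cat_uniq !map_inj_uniq ?iota_uniq /=; [|by move=> ? ? []..].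
  by rewrite andbT; apply/hasPn => _ /mapP [i _ ->]; apply/mapP => -[].
- move=> [i|i] ei; rewrite mem_cat; apply/orP; [left|right];
    by rewrite map_f // mem_iota; nia.
rewrite big_cat !big_map fcoefB mulr_natl fcoefMn fcoef_sum fcoef1.
have cE s : ((-1) ^+ s * X ^+ (s * s) : fps K).@[n] =
    if Posz s * Posz s == n%:Z then sg K s else 0.
  rewrite /sg -exprnP -[in LHS]signr_odd -[in RHS]signr_odd -PoszM eqz_nat eq_sym.
  case: (odd s); rewrite ?expr1 ?expr0 ?mulN1r ?mul1r ?fcoefN fcoefXn;
    by case: eqP => //=; rewrite oppr0.
rewrite [X in X *+ 2](eq_bigr _ (fun s _ => cE s)) /= mulr2n -addrA.
rewrite [X in X + _ = _]big_mkcond; congr (_ + _).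
rewrite big_ltn // addrAC big_add1 /= /index_iota subn0 big_mkcond /=.
rewrite (_ : (if _ then _ else _) = (n == 0)%:R); last first.
  by case: n {cE} nN => [|n] nN; rewrite ?eqxx //; case: eqP => //; lia.
rewrite subrr add0r; apply: eq_bigr => i _.
have -> : Negz i = - i.+1%:Z by lia.
by rewrite sgN mulrNN.
Qed.

Lemma psiS_eqmod N : fps_eqmod N (psiS K)
  (\sum_(0 <= j < N) X ^+ 'C(j.+1, 2)).
Proof.
have triC j : tri j%:Z = 'C(j.+1, 2)%:Z.
  have := odd_double_half (j.+1 * j); rewrite -bin2 oddM andNb.
  by have := triE j%:Z; nia.
move=> n nN; rewrite /psiS (@theta_coef _ _ _ _ (iota 0 N)) ?iota_uniq //.
  rewrite fcoef_sum /index_iota subn0 big_mkcond; apply: eq_bigr => j _.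
  by rewrite triC fcoefXn eqz_nat eq_sym; case: eqP.
by move=> j; rewrite mem_iota; have := triE j%:Z; nia.
Qed.

(** With [A] the product of the 1 + X^k, one has A E(q) = E(q^2) at the level of partial products,
    and A phi(-q) agrees with E(q) modulo X^(N+1) by the finite identity. *)
Lemma phiMS_euler : phiMS K * dil 2 eulerS = eulerS ^+ 2.
Proof.
apply: fps_eqmodP => N; suff: fps_eqmod N.+1 (phiMS K * dil 2 eulerS) (eulerS ^+ 2).
  by move=> h n nN; apply: h; lia.
pose A : fps K := \prod_(1 <= k < N.+1) (1 + X ^+ k).
have AE : A * eulerP N = dil 2 (eulerP N).
  rewrite /A /eulerP -big_split rmorph_prod /=; apply: eq_bigr => k _.
  by rewrite rmorphB rmorph1 rmorphXn /= fps_dilX // exprAC; ring.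
have AP : fps_eqmod N.+1 (A * phiMS K) (eulerP N).
  apply: (fps_eqmod_trans (fps_eqmodM (@fps_eqmod_refl _ _ A) (@phiMS_eqmod N))).
  rewrite gauss_phi_finite big_ltn // expr0 mul1r mul0n expr0 mul1r big_geq // mul1r.
  rewrite (_ : \sum_(1 <= i < _) _ = X ^+ N.+1 * \sum_(1 <= s < N.+1)
     ((-1) ^+ s * X ^+ (s.-1 * N.+1) * \prod_(0 <= k < s) (1 + X ^+ k) *
    \prod_(s.+1 <= k < N.+1) (1 - X ^+ k))).
    exact: fps_eqmod_addXn.
  rewrite big_distrr; apply: eq_big_nat => s /andP [s0 _] /=.
  by rewrite -(prednK s0) mulSn exprD /=; ring.
have EN := @fps_eqmod_eulerP N.
apply: (fps_eqmod_trans (fps_eqmodM (@fps_eqmod_refl _ _ _)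
  (fps_eqmod_dil (isT : (0 < 2)%N) EN))).
rewrite -AE mulrA [phiMS K * _]mulrC expr2.
apply: fps_eqmodM; last exact: fps_eqmod_sym.
exact: fps_eqmod_trans AP (fps_eqmod_sym EN).
Qed.

(** Odd factors [A] and even factors [V] make up the Euler product, and A psi(q) agrees with V; so
    psi(q) E(q) agrees with V^2. *)
Lemma psiS_euler : psiS K * eulerS = dil 2 eulerS ^+ 2.
Proof.
apply: fps_eqmodP => N.
pose V : fps K := dil 2 (eulerP N).
pose A : fps K := \prod_(1 <= k < N.+1) (1 - X ^+ k.*2.-1).
have VE : V = \prod_(1 <= k < N.+1) (1 - X ^+ k.*2).
  rewrite /V /eulerP rmorph_prod /=; apply: eq_bigr => k _.
  by rewrite rmorphB rmorph1 rmorphXn /= fps_dilX // -exprM mul2n.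
have AV : A * V = eulerP N.*2.
  rewrite VE /A /eulerP; elim: (N) => [|n IH]; first by rewrite !big_geq ?mulr1.
  rewrite doubleS (@big_nat_recr _ _ _ n.+1 1) // (@big_nat_recr _ _ _ n.+1 1) //.
  rewrite (@big_nat_recr _ _ _ n.*2.+2 1) // (@big_nat_recr _ _ _ n.*2.+1 1) //= -IH.
  by rewrite doubleS /=; ring.
have AP : fps_eqmod N (A * psiS K) V.
  have pE : fps_eqmod N (psiS K) (\sum_(0 <= j < N.*2) X ^+ 'C(j.+1, 2)).
    by move=> n nN; apply: psiS_eqmod; lia.
  apply: (fps_eqmod_trans (fps_eqmodM (@fps_eqmod_refl _ _ _) pE)).
  case: (posnP N) => [-> //|N0].
  rewrite -gauss_psi_finite big_ltn // mul0n expr0 mul1r big_geq // mul1r -VE.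
  rewrite (_ : \sum_(1 <= i < _) _ = X ^+ N.*2.+1 * \sum_(1 <= s < N)
     (X ^+ (s.-1 * N.*2.+1) * \prod_(1 <= k < s.+1) (1 - X ^+ k.*2.-1) *
    \prod_(s.+1 <= k < N.+1) (1 - X ^+ k.*2))).
    by apply: fps_eqmod_addXn; lia.
  rewrite big_distrr; apply: eq_big_nat => s /andP [s0 _] /=.
  by rewrite -(prednK s0) mulSn exprD /=; ring.
have EN : fps_eqmod N eulerS (A * V).
  by rewrite AV => n nN; apply: fps_eqmod_eulerP; lia.
apply: (fps_eqmod_trans (fps_eqmodM (@fps_eqmod_refl _ _ _) EN)).
have VN : fps_eqmod N V (dil 2 eulerS).
  by apply: fps_eqmod_dil => // n nN; symmetry; apply: fps_eqmod_eulerP; lia.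
rewrite mulrA [psiS K * _]mulrC expr2.
by apply: fps_eqmodM => //; apply: fps_eqmod_trans VN.
Qed.

End Gauss.

(** * The cubic relation of level 7 *)

Section Algebra.
Variable F : fieldType.
Hypothesis two_neq0 : (2 : F) != 0.

(** Jacobi's phi(q)^4 - phi(-q)^4 = 16 q psi(q^2)^4 in terms of E. Here x, y, w, v are E at q, q^2,
    q^4, q^8; M, M2, M4 are phi(-q), phi(-q^2), phi(-q^4); P, P2 are phi(q), phi(q^2); p4 is
    psi(q^4), and p4 P2 = psi(q^2)^2. *)
Lemma jacobi_alg (q x y w v M M2 M4 P P2 p4 : F) :
  x != 0 -> y != 0 -> w != 0 -> v != 0 ->
  M * y = x ^+ 2 -> M2 * w = y ^+ 2 -> M4 * v = w ^+ 2 -> p4 * w = v ^+ 2 ->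
  P * M = M2 ^+ 2 -> P2 * M2 = M4 ^+ 2 ->
  P ^+ 2 + M ^+ 2 = 2 * P2 ^+ 2 -> P ^+ 2 - M ^+ 2 = 8 * q * p4 ^+ 2 ->
  y ^+ 24 = x ^+ 16 * w ^+ 8 + 16 * q * x ^+ 8 * w ^+ 16.
Proof.
move=> x0 y0 w0 v0 /(canRL (mulfK y0)) ME /(canRL (mulfK w0)) M2E.
move=> /(canRL (mulfK v0)) M4E /(canRL (mulfK w0)) pE PM PM2 Padd Psub.
have PE : P = y ^+ 5 / (w ^+ 2 * x ^+ 2).
  have M0 : M != 0 by rewrite ME mulf_neq0 ?expf_neq0 ?invr_eq0.
  by rewrite -[P](mulfK M0) PM M2E ME; field; rewrite x0 y0 w0.
have P2E : P2 = w ^+ 5 / (v ^+ 2 * y ^+ 2).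
  have M0 : M2 != 0 by rewrite M2E mulf_neq0 ?expf_neq0 ?invr_eq0.
  by rewrite -[P2](mulfK M0) PM2 M4E M2E; field; rewrite v0 y0 w0.
have key : P ^+ 4 - M ^+ 4 = 16 * q * (p4 * P2) ^+ 2.
  transitivity ((P ^+ 2 + M ^+ 2) * (P ^+ 2 - M ^+ 2)); first by ring.
  by rewrite Padd Psub; ring.
apply/eqP; rewrite -subr_eq0; apply/eqP.
transitivity ((P ^+ 4 - M ^+ 4 - 16 * q * (p4 * P2) ^+ 2) * (y ^+ 4 * x ^+ 8 * w ^+ 8)).
  by rewrite PE ME P2E pE; field; rewrite x0 y0 w0 v0.
by rewrite key subrr mul0r.
Qed.

(* Here u = g(q) / f(q), r = f(q) / f(q^2), and S, S' are the values at q and q^2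
   of t(q^2) / t(q).  The relation between u and r makes u rational in r; the
   value of u at q^2 is u^2 r^3. *)
Section Modular.
Variables (r u S S' : F).
Hypotheses (r0 : r != 0) (u0 : u != 0) (S0 : S != 0) (S0' : S' != 0).
Hypothesis ru : 2 * u * r ^+ 2 + r = 1.
Hypothesis J1 : S ^+ 2 = r ^+ 4 * S' + (1 - r) ^+ 4 * S * S' ^+ 2.
Hypothesis J2 : S' ^+ 2 = r ^+ 4 * S ^+ 2 * S' + (1 - r) ^+ 4 * S.

Let a := S + S^-1.
Let b := 7 + u^-1 + 8 * u.
Let p := S * S'.
(** The value of p + 1/p forced by (r^4 + (1 - r)^4 p) (r^4 + (1 - r)^4 / p) = 1, the product of S^2
    / S' and S' / S^2. *)
Let c1 := (1 - r ^+ 8 - (1 - r) ^+ 8) / (r * (1 - r)) ^+ 4.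

Lemma mod_uE : u = (1 - r) / (2 * r ^+ 2).
Proof.
have -> : 1 - r = 2 * u * r ^+ 2 by rewrite -{1}ru addrK.
by field; rewrite two_neq0 r0.
Qed.

Lemma mod_r1 : 1 - r != 0.
Proof.
by rewrite -{1}ru addrK !mulf_neq0 ?expf_neq0.
Qed.

Let p0 : p != 0. Proof. by rewrite mulf_neq0. Qed.

Let j1 : S ^+ 2 / S' = r ^+ 4 + (1 - r) ^+ 4 * p.
Proof. by rewrite J1 /p; field. Qed.

Let j2 : S' / S ^+ 2 = r ^+ 4 + (1 - r) ^+ 4 / p.
Proof.
have -> : S' / S ^+ 2 = S' ^+ 2 / (S ^+ 2 * S') by field; rewrite S0 S0'.
by rewrite J2 /p; field; rewrite S0 S0'.
Qed.

Let c1E : p + p^-1 = c1.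
Proof.
have r1 := mod_r1.
have : (S ^+ 2 / S') * (S' / S ^+ 2) = 1 by field; rewrite S0 S0'.
rewrite j1 j2 => e.
rewrite /c1 -{1}e; field.
by rewrite r0 r1 p0.
Qed.

Let cubeE : S ^+ 3 + S ^- 3 = r ^+ 4 * c1 + (1 - r) ^+ 4 * (c1 ^+ 2 - 2).
Proof.
have -> : S ^+ 3 + S ^- 3 = p * (S ^+ 2 / S') + p^-1 * (S' / S ^+ 2).
  by rewrite /p; field; rewrite S0 S0'.
by rewrite j1 j2 -c1E; field.
Qed.

(* With p = S S', J1 and J2 give S^2 / S' and S' / S^2 as affine functions of p and
   1 / p, whence p + 1/p and then S^3 + S^-3 in terms of r alone. *)
Lemma mod_cubic : (a - b) * (a ^+ 2 + a * b + b ^+ 2 - 3) = 0.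
Proof.
have r1 := mod_r1.
(* Since S^3 + S^-3 = a^3 - 3 a, the product is (a^3 - 3 a) - (b^3 - 3 b). It remains to compare b^3
   - 3 b with [cubeE] as rational functions of r. *)
transitivity (S ^+ 3 + S ^- 3 - (b ^+ 3 - 3 * b)); first by rewrite /a; field.
rewrite cubeE /c1 /b mod_uE; field.
by rewrite two_neq0 r0 r1.
Qed.

Hypothesis ab : a = b.
Let e := r ^+ 4 + (1 - r) ^+ 4 * c1.
Hypothesis e0 : e != 0.

(** The antisymmetric analogue of [cubeE]: S^3 - S^-3 equals both (p - 1/p) e and d (a^2 - 1) with d
    = S - 1/S, so p - 1/p is proportional to d. As S' = p / S, this passes to S' - 1/S'. *)
Lemma mod_diff : u * (1 - 8 * (u ^+ 2 * r ^+ 3)) * (S' - S'^-1) =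
  (1 - u) * (S - S^-1).
Proof.
have r1 := mod_r1; pose d := S - S^-1.
have pd : (p - p^-1) * e = d * (b ^+ 2 - 1).
  transitivity (p * (S ^+ 2 / S') - p^-1 * (S' / S ^+ 2)).
    by rewrite j1 j2 /e -c1E; field.
  rewrite -ab /p /d /a; field.
  by rewrite S0 S0'.
have sd : 2 * (S' - S'^-1) = (p - p^-1) * b - c1 * d.
  by rewrite -c1E -ab /a /d /p; field; rewrite S0 S0'.
have be : u * (1 - 8 * (u ^+ 2 * r ^+ 3)) * (b * (b ^+ 2 - 1) - c1 * e) =
    2 * e * (1 - u).
  by rewrite /e /b /c1 mod_uE; field; rewrite two_neq0 r0 r1.
apply: (mulfI (mulf_neq0 two_neq0 e0)).
transitivity (u * (1 - 8 * (u ^+ 2 * r ^+ 3)) * (e * (2 * (S' - S'^-1)))).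
  by ring.
have -> : e * (2 * (S' - S'^-1)) = d * (b * (b ^+ 2 - 1) - c1 * e).
  by rewrite sd mulrBr [e * (_ * b)]mulrA [e * (p - _)]mulrC pd; ring.
by rewrite mulrCA be; rewrite /d; ring.
Qed.

(** The transformation law T(q^2) = S T(q), doubled. *)
Lemma mod_level7 :
  let c := (1 + 4 * u) ^+ 3 / u - 13 in
  let u' := u ^+ 2 * r ^+ 3 in
  let c' := (1 + 4 * u') ^+ 3 / u' - 13 in
  c' + (1 - 8 * u') * (S' - S'^-1) = S * (c + (1 - 8 * u) * (S - S^-1)).
Proof.
move=> c u' c'; have r1 := mod_r1.
(* The counterpart of z(q^2) = f + 2 g together with f(q^2)^2 g(q^2) = f g^2. *)
have -> : c' = (1 + 2 * u) ^+ 3 / u ^+ 2 - 13.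
  by rewrite /c' /u' mod_uE; field; rewrite two_neq0 r0 r1.
have -> : (1 - 8 * u') * (S' - S'^-1) = (1 - u) / u * (S - S^-1).
  apply: (mulfI u0); rewrite mulrA mod_diff; field.
  by rewrite S0 u0.
(* Reducing by S^2 = b S - 1 makes both sides affine in S, with coefficients in u alone. *)
have SE : S ^- 1 = b - S by rewrite -ab /a; ring.
have S2 : S * S = b * S - 1 by rewrite -ab /a; field.
rewrite [in RHS]mulrDr [S * (_ * _)]mulrCA [S * (S - _)]mulrBr mulfV // S2 SE.
by rewrite /c /b; field.
Qed.

(** Completing the square: c^2 - 196 = (1 - 8 u)^2 (b^2 - 4), and b^2 - 4 = (S - 1/S)^2. *)
Lemma mod_quadratic t : t != 0 ->
  2 * t = (1 + 4 * u) ^+ 3 / u - 13 + (1 - 8 * u) * (S - S^-1) ->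
  t + 13 + 49 / t = (1 + 4 * u) ^+ 3 / u.
Proof.
move=> t0; set c := _ - 13 => tE.
suff e4 : 4 * (t ^+ 2 - c * t + 49) = 0.
  have e1 : t ^+ 2 - c * t + 49 = 0.
    by apply: (mulfI (mulf_neq0 two_neq0 two_neq0)); rewrite mulr0 -e4; ring.
  apply: (mulfI t0).
  have -> : (1 + 4 * u) ^+ 3 / u = c + 13 by rewrite /c; ring.
  apply/eqP; rewrite -subr_eq0; apply/eqP; rewrite -e1; field.
  by rewrite t0.
transitivity ((2 * t - c) ^+ 2 - c ^+ 2 + 196); first by ring.
have -> : 2 * t - c = (1 - 8 * u) * (S - S^-1) by rewrite tE; ring.
have -> : ((1 - 8 * u) * (S - S^-1)) ^+ 2 = (1 - 8 * u) ^+ 2 * (b ^+ 2 - 4).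
  by rewrite -ab /a; field.
by rewrite /b /c; field.
Qed.

End Modular.
End Algebra.

(* In what follows x, y, w stand for E(q), E(q^2), E(q^4) and x7, y7, w7 for the
   same functions of q^7.  This is 2 T times q (x x7)^7 (y y7)^4, where T is the
   root described at the top. *)
Definition level7_numer (R : pzRingType) (q x y x7 y7 z : R) : R :=
  z ^+ 3 * (x * x7 * y * y7) ^+ 4 - 13 * q * (x * x7) ^+ 7 * (y * y7) ^+ 4 +
  ((x * x7) ^+ 3 - 8 * q * (y * y7) ^+ 3) *
    ((y * x7) ^+ 8 - q ^+ 2 * (x * y7) ^+ 8).

(* S + 1/S and 7 + 1/u + 8 u over a common denominator. *)
Definition level14_den (R : pzRingType) (q x y x7 y7 : R) : R :=
  q * (x * y * x7 * y7) ^+ 4.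

Definition level14_numS (R : pzRingType) (q x y x7 y7 : R) : R :=
  (y * x7) ^+ 8 + q ^+ 2 * (x * y7) ^+ 8.

Definition level14_numu (R : pzRingType) (q x y x7 y7 : R) : R :=
  7 * level14_den q x y x7 y7 + (x * x7) ^+ 7 * (y * y7) +
  8 * q ^+ 2 * (x * x7) * (y * y7) ^+ 7.

(** * The modular relations in terms of values of E *)

Section Specialization.
Variables (F : fieldType) (q x y w x7 y7 w7 : F).
Hypotheses (q0 : q != 0) (x0 : x != 0) (y0 : y != 0) (w0 : w != 0).
Hypotheses (x70 : x7 != 0) (y70 : y7 != 0) (w70 : w7 != 0).

Let f := x ^+ 2 * x7 ^+ 2 / (y * y7).
Let g := q * y ^+ 2 * y7 ^+ 2 / (x * x7).
Let f2 := y ^+ 2 * y7 ^+ 2 / (w * w7).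
Let u := g / f.
Let r := f / f2.
Let S := (y * x7) ^+ 4 / (q * (x * y7) ^+ 4).
Let S' := (w * y7) ^+ 4 / (q ^+ 2 * (y * w7) ^+ 4).

(** In r^4 S' / S^2 = x^16 w^8 / y^24 the functions of q^7 cancel, so this is Jacobi's identity up
    to a monomial. In [spec_J2] the functions of q cancel instead, leaving the identity at q^7. *)
Lemma spec_J1 : y ^+ 24 = x ^+ 16 * w ^+ 8 + 16 * q * x ^+ 8 * w ^+ 16 ->
  S ^+ 2 = r ^+ 4 * S' + (2 * u * r ^+ 2) ^+ 4 * S * S' ^+ 2.
Proof.
move=> H; apply/eqP; rewrite -subr_eq0; apply/eqP.
transitivity ((y ^+ 24 - (x ^+ 16 * w ^+ 8 + 16 * q * x ^+ 8 * w ^+ 16)) *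
   (x7 ^+ 8 / (q ^+ 2 * x ^+ 8 * y7 ^+ 8 * y ^+ 16))).
  rewrite /S /S' /r /u /f2 /g /f; field.
  by rewrite ?q0 ?x0 ?y0 ?w0 ?x70 ?y70 ?w70.
by rewrite H subrr mul0r.
Qed.

Lemma spec_J2 : y7 ^+ 24 = x7 ^+ 16 * w7 ^+ 8 + 16 * q ^+ 7 * x7 ^+ 8 * w7 ^+ 16 ->
  S' ^+ 2 = r ^+ 4 * S ^+ 2 * S' + (2 * u * r ^+ 2) ^+ 4 * S.
Proof.
move=> H; apply/eqP; rewrite -subr_eq0; apply/eqP.
transitivity ((y7 ^+ 24 - (x7 ^+ 16 * w7 ^+ 8 + 16 * q ^+ 7 * x7 ^+ 8 * w7 ^+ 16)) *
   (w ^+ 8 / (q ^+ 4 * y ^+ 8 * w7 ^+ 8 * y7 ^+ 16))).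
  rewrite /S /S' /r /u /f2 /g /f; field.
  by rewrite ?q0 ?x0 ?y0 ?w0 ?x70 ?y70 ?w70.
by rewrite H subrr mul0r.
Qed.

Lemma spec_numer :
  (1 + 4 * u) ^+ 3 / u - 13 + (1 - 8 * u) * (S - S^-1) =
  level7_numer q x y x7 y7 (f + 4 * g) /
    (q * (x * x7) ^+ 7 * (y * y7) ^+ 4).
Proof.
rewrite /level7_numer /u /S /g /f; field.
by rewrite ?q0 ?x0 ?y0 ?w0 ?x70 ?y70 ?w70.
Qed.

End Specialization.

Section Descent.
Variables (F : fieldType) (q x y w x7 y7 w7 : F).
Hypotheses (q0 : q != 0) (x0 : x != 0) (y0 : y != 0) (w0 : w != 0).
Hypotheses (x70 : x7 != 0) (y70 : y7 != 0) (w70 : w7 != 0).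

Let f := x ^+ 2 * x7 ^+ 2 / (y * y7).
Let g := q * y ^+ 2 * y7 ^+ 2 / (x * x7).
Let f2 := y ^+ 2 * y7 ^+ 2 / (w * w7).
Let u := g / f.
Let r := f / f2.
Let S := (y * x7) ^+ 4 / (q * (x * y7) ^+ 4).
Let S' := (w * y7) ^+ 4 / (q ^+ 2 * (y * w7) ^+ 4).
Let g2 := q ^+ 2 * w ^+ 2 * w7 ^+ 2 / (y * y7).

Let trace_den := level14_den q x y x7 y7.
Let trace_S := level14_numS q x y x7 y7.
Let trace_u := level14_numu q x y x7 y7.

Hypothesis two_neq0 : (2 : F) != 0.
Hypothesis H1 : y ^+ 24 = x ^+ 16 * w ^+ 8 + 16 * q * x ^+ 8 * w ^+ 16.
Hypothesis H7 : y7 ^+ 24 = x7 ^+ 16 * w7 ^+ 8 + 16 * q ^+ 7 * x7 ^+ 8 * w7 ^+ 16.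
Hypothesis Hfg : f2 + 4 * g2 = f + 2 * g.
(** [nz1], [nz2] and [nz3] rule out, in turn, the root f2 = 2 g in [spec_ru], the quadratic factor
    in [mod_cubic], and the vanishing of the divisor e in [mod_diff]. At q = 0 the three series take
    the values 1, 3 and 1. *)
Hypothesis nz1 : f2 - 2 * g != 0.
Hypothesis nz2 : trace_S ^+ 2 + trace_S * trace_u + trace_u ^+ 2 -
  3 * trace_den ^+ 2 != 0.
Hypothesis nz3 : f2 ^+ 8 - (f2 - f) ^+ 8 != 0.

Let f0 : f != 0. Proof. by rewrite !mulf_neq0 ?invr_eq0 ?mulf_neq0 ?expf_neq0. Qed.
Let g0 : g != 0. Proof. by rewrite !mulf_neq0 ?invr_eq0 ?mulf_neq0 ?expf_neq0. Qed.
Let f20 : f2 != 0. Proof. by rewrite !mulf_neq0 ?invr_eq0 ?mulf_neq0 ?expf_neq0. Qed.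
Let u0 : u != 0. Proof. by rewrite mulf_neq0 ?invr_eq0. Qed.
Let r0 : r != 0. Proof. by rewrite mulf_neq0 ?invr_eq0. Qed.
Let S0 : S != 0.
Proof. by rewrite mulf_neq0 ?invr_eq0 ?mulf_neq0 ?expf_neq0 ?mulf_neq0. Qed.
Let S0' : S' != 0.
Proof. by rewrite mulf_neq0 ?invr_eq0 ?mulf_neq0 ?expf_neq0 ?mulf_neq0. Qed.

(** Eliminating g2 between f2 + 4 g2 = f + 2 g and g2 f2^2 = f g^2 leaves a cubic in f2 with root 2
    g; the cofactor divided by f2^2 is the relation. *)
Lemma spec_ru : 2 * u * r ^+ 2 + r = 1.
Proof.
have g2E : g2 * f2 ^+ 2 = g ^+ 2 * f.
  by rewrite /g2 /f2 /g /f; field; rewrite ?q0 ?x0 ?y0 ?w0 ?x70 ?y70 ?w70.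
have e0 : (f2 - 2 * g) * (f2 ^+ 2 - f * f2 - 2 * g * f) = 0.
  transitivity (f2 ^+ 2 * (f2 - f - 2 * g) + 4 * (g ^+ 2 * f)); first by ring.
  rewrite -g2E; transitivity (f2 ^+ 2 * ((f2 + 4 * g2) - (f + 2 * g))); first by ring.
  by rewrite Hfg subrr mulr0.
have e1 : f2 ^+ 2 - f * f2 - 2 * g * f = 0 by apply: (mulfI nz1); rewrite e0 mulr0.
apply: (mulfI (expf_neq0 2 f20)); apply/eqP; rewrite -subr_eq0; apply/eqP.
transitivity (- (f2 ^+ 2 - f * f2 - 2 * g * f)); last by rewrite e1 oppr0.
by rewrite /u /r; field; rewrite f0 f20.
Qed.

Let ru := spec_ru.

Let ru' : 1 - r = 2 * u * r ^+ 2. Proof. by rewrite -{1}ru addrK. Qed.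

Let J1 : S ^+ 2 = r ^+ 4 * S' + (1 - r) ^+ 4 * S * S' ^+ 2.
Proof. by rewrite ru'; exact: spec_J1. Qed.

Let J2 : S' ^+ 2 = r ^+ 4 * S ^+ 2 * S' + (1 - r) ^+ 4 * S.
Proof. by rewrite ru'; exact: spec_J2. Qed.

Lemma spec_trace : S + S^-1 = 7 + u^-1 + 8 * u.
Proof.
have SE : (S + S^-1) * trace_den = trace_S.
  rewrite /S /trace_den /trace_S /level14_den /level14_numS; field.
  by rewrite ?q0 ?x0 ?y0 ?w0 ?x70 ?y70 ?w70.
have uE : (7 + u^-1 + 8 * u) * trace_den = trace_u.
  rewrite /u /f /g /trace_den /trace_u /level14_numu /level14_den; field.
  by rewrite ?q0 ?x0 ?y0 ?w0 ?x70 ?y70 ?w70.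
have /eqP := mod_cubic two_neq0 r0 u0 S0 S0' ru J1 J2.
rewrite mulf_eq0 subr_eq0 => /orP [/eqP //|/eqP h]; case/eqP: nz2.
rewrite -SE -uE -[RHS](mulr0 (trace_den ^+ 2)) -h; ring.
Qed.

Let e0 : r ^+ 4 + (1 - r) ^+ 4 *
  ((1 - r ^+ 8 - (1 - r) ^+ 8) / (r * (1 - r)) ^+ 4) != 0.
Proof.
have r1 : 1 - r != 0 by apply: mod_r1 ru.
apply: contraNneq nz3 => e.
have -> : f2 ^+ 8 - (f2 - f) ^+ 8 = f2 ^+ 8 * (1 - (1 - r) ^+ 8).
  by rewrite /r; field.
rewrite -[1 - _ ^+ 8](_ : (r ^+ 4 + (1 - r) ^+ 4 *
  ((1 - r ^+ 8 - (1 - r) ^+ 8) / (r * (1 - r)) ^+ 4)) * r ^+ 4 = _).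
  by rewrite e mul0r mulr0.
by field; rewrite r0 r1.
Qed.

(** The factor 2 x^11 x7^3 (y y7)^4 is 2 t times the denominator q (x x7)^7 (y y7)^4 of T, so this
    is the invariance of T / t under q -> q^2, free of poles. *)
Lemma spec_ratio :
  level7_numer q x y x7 y7 (f + 4 * g) *
    (2 * y ^+ 11 * y7 ^+ 3 * (w * w7) ^+ 4) =
  level7_numer (q ^+ 2) y w y7 w7 (f2 + 4 * g2) *
    (2 * x ^+ 11 * x7 ^+ 3 * (y * y7) ^+ 4).
Proof.
have h := spec_numer q0 x0 y0 x70 y70.
have h' := spec_numer (expf_neq0 2 q0) y0 w0 y70 w70.
have := mod_level7 two_neq0 r0 u0 S0 S0' ru J1 J2 spec_trace e0.
rewrite /= (_ : u ^+ 2 * r ^+ 3 = g2 / f2); last first.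
  rewrite /u /r /g2 /f2 /g /f; field.
  by rewrite ?q0 ?x0 ?y0 ?w0 ?x70 ?y70 ?w70.
move: h h'; rewrite -/f -/g -/u -/S.
rewrite -/f2 -/g2 -/S' => -> -> /(congr1 (fun z => z * (2 * q ^+ 2 * (y * y7) ^+ 7
  * (w * w7) ^+ 4 * x ^+ 11 * x7 ^+ 3 * (y * y7) ^+ 4))) e.
transitivity (S * (level7_numer q x y x7 y7 (f + 4 * g) /
    (q * (x * x7) ^+ 7 * (y * y7) ^+ 4)) * (2 * q ^+ 2 * (y * y7) ^+ 7
  * (w * w7) ^+ 4 * x ^+ 11 * x7 ^+ 3 * (y * y7) ^+ 4)).
  by rewrite /S; field; rewrite ?q0 ?x0 ?y0 ?w0 ?x70 ?y70 ?w70.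
rewrite -e; field.
by rewrite ?q0 ?x0 ?y0 ?w0 ?x70 ?y70 ?w70.
Qed.

(** The premise is T = t; the conclusion is the quadratic for t multiplied by q x^4 x7^4. *)
Lemma spec_cubic :
  level7_numer q x y x7 y7 (f + 4 * g) = 2 * x ^+ 11 * x7 ^+ 3 * (y * y7) ^+ 4 ->
  (f + 4 * g) ^+ 3 * (x * x7) =
  x ^+ 8 + 13 * q * x ^+ 4 * x7 ^+ 4 + 49 * q ^+ 2 * x7 ^+ 8.
Proof.
move=> nE; pose t := x ^+ 4 / (q * x7 ^+ 4).
have t0 : t != 0 by rewrite mulf_neq0 ?invr_eq0 ?mulf_neq0 ?expf_neq0.
have tE : 2 * t = (1 + 4 * u) ^+ 3 / u - 13 + (1 - 8 * u) * (S - S^-1).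
  rewrite [RHS](spec_numer q0 x0 y0 x70 y70) nE /t; field.
  by rewrite ?q0 ?x0 ?y0 ?w0 ?x70 ?y70 ?w70.
have /(congr1 (fun z => z * (q * x ^+ 4 * x7 ^+ 4))) h :=
  mod_quadratic two_neq0 u0 S0 spec_trace t0 tE.
transitivity ((1 + 4 * u) ^+ 3 / u * (q * x ^+ 4 * x7 ^+ 4)).
  rewrite /u /g /f; field.
  by rewrite ?q0 ?x0 ?y0 ?w0 ?x70 ?y70 ?w70.
rewrite -h /t; field.
by rewrite ?q0 ?x0 ?y0 ?w0 ?x70 ?y70 ?w70.
Qed.

End Descent.

(** * From the fraction field back to the integral domain *)

Section DomainAlgebra.
Variable D : idomainType.
Local Notation tof := (@tofrac D).
Implicit Types q x y w v : D.

Lemma tofrac_nat n : tof n%:R = n%:R.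
Proof. exact: rmorph_nat. Qed.

Lemma tofrac_neq0 x : x != 0 -> tof x != 0.
Proof. by rewrite tofrac_eq0. Qed.

Lemma jacobi_domain q x y w v (M M2 M4 P P2 p4 : D) : (2 : D) != 0 ->
  x != 0 -> y != 0 -> w != 0 -> v != 0 ->
  M * y = x ^+ 2 -> M2 * w = y ^+ 2 -> M4 * v = w ^+ 2 -> p4 * w = v ^+ 2 ->
  P * M = M2 ^+ 2 -> P2 * M2 = M4 ^+ 2 ->
  P ^+ 2 + M ^+ 2 = 2 * P2 ^+ 2 -> P ^+ 2 - M ^+ 2 = 8 * q * p4 ^+ 2 ->
  y ^+ 24 = x ^+ 16 * w ^+ 8 + 16 * q * x ^+ 8 * w ^+ 16.
Proof.
move=> two0 x0 y0 w0 v0 H1 H2 H3 H4 H5 H6 H7 H8.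
apply/eqP; rewrite -tofrac_eq !(tofrac_nat, tofracXn, tofracM, tofracD); apply/eqP.
apply: (@jacobi_alg _ (tof q) _ _ _ (tof v) (tof M) (tof M2) (tof M4) (tof P)
  (tof P2) (tof p4)); try exact: tofrac_neq0.
all: rewrite -?(tofrac_nat 2) -?(tofrac_nat 8) -?(tofracXn, tofracM);
  rewrite -?tofracM -?tofracB -?tofracD; by congr tofrac.
Qed.

End DomainAlgebra.

Section DescentDomain.
Variables (D : idomainType) (q x y w x7 y7 w7 f g f2 g2 : D).
Local Notation tof := (@tofrac D).
Hypotheses (q0 : q != 0) (x0 : x != 0) (y0 : y != 0) (w0 : w != 0).
Hypotheses (x70 : x7 != 0) (y70 : y7 != 0) (w70 : w7 != 0).
Hypothesis fE : f * (y * y7) = x ^+ 2 * x7 ^+ 2.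
Hypothesis gE : g * (x * x7) = q * (y ^+ 2 * y7 ^+ 2).
Hypothesis f2E : f2 * (w * w7) = y ^+ 2 * y7 ^+ 2.
Hypothesis g2E : g2 * (y * y7) = q ^+ 2 * (w ^+ 2 * w7 ^+ 2).
Hypothesis two_neq0 : (2 : D) != 0.
Hypothesis H1 : y ^+ 24 = x ^+ 16 * w ^+ 8 + 16 * q * x ^+ 8 * w ^+ 16.
Hypothesis H7 : y7 ^+ 24 = x7 ^+ 16 * w7 ^+ 8 + 16 * q ^+ 7 * x7 ^+ 8 * w7 ^+ 16.
Hypothesis Hfg : f2 + 4 * g2 = f + 2 * g.
Hypothesis nz1 : f2 - 2 * g != 0.
Hypothesis nz2 : level14_numS q x y x7 y7 ^+ 2 +
  level14_numS q x y x7 y7 * level14_numu q x y x7 y7 +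
  level14_numu q x y x7 y7 ^+ 2 - 3 * level14_den q x y x7 y7 ^+ 2 != 0.
Hypothesis nz3 : f2 ^+ 8 - (f2 - f) ^+ 8 != 0.

Let tofE := (@tofrac_nat D, @tofracXn D, @tofracM D, @tofracB D, @tofracD D).
Let tn := @tofrac_neq0 D.

Let tdiv a b c : b != 0 -> a * b = c -> tof a = tof c / tof b.
Proof. by move=> b0 <-; rewrite tofracM mulfK // tn. Qed.

Let tfE : tof f = tof x ^+ 2 * tof x7 ^+ 2 / (tof y * tof y7).
Proof. by rewrite (tdiv _ fE) ?mulf_neq0 // !tofE. Qed.
Let tgE : tof g = tof q * tof y ^+ 2 * tof y7 ^+ 2 / (tof x * tof x7).
Proof. by rewrite (tdiv _ gE) ?mulf_neq0 // mulrA !tofE. Qed.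
Let tf2E : tof f2 = tof y ^+ 2 * tof y7 ^+ 2 / (tof w * tof w7).
Proof. by rewrite (tdiv _ f2E) ?mulf_neq0 // !tofE. Qed.
Let tg2E : tof g2 = tof q ^+ 2 * tof w ^+ 2 * tof w7 ^+ 2 / (tof y * tof y7).
Proof. by rewrite (tdiv _ g2E) ?mulf_neq0 // mulrA !tofE. Qed.

Let tinj a b : tof a = tof b -> a = b.
Proof. by move/eqP; rewrite tofrac_eq => /eqP. Qed.

Let two : (2 : {fraction D}) != 0. Proof. by rewrite -(tofrac_nat D 2) tn. Qed.
Let tH1 := congr1 tof H1.
Let tH7 := congr1 tof H7.
Let tHfg := congr1 tof Hfg.
Let tnz1 := tn nz1.
Let tnz2 := tn nz2.
Let tnz3 := tn nz3.

Lemma descent_ratio :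
  level7_numer q x y x7 y7 (f + 4 * g) *
    (2 * y ^+ 11 * y7 ^+ 3 * (w * w7) ^+ 4) =
  level7_numer (q ^+ 2) y w y7 w7 (f2 + 4 * g2) *
    (2 * x ^+ 11 * x7 ^+ 3 * (y * y7) ^+ 4).
Proof.
move: tH1 tH7 tHfg tnz1 tnz2 tnz3; rewrite /level14_numu /level14_numS /level14_den.
rewrite !tofE => h1 h7 hfg h2 h3 h4.
apply: tinj; rewrite /level7_numer !tofE.
rewrite tfE tgE tf2E tg2E in hfg h2 h4 *.
exact: (spec_ratio (tn q0) (tn x0) (tn y0) (tn w0) (tn x70) (tn y70) (tn w70)).
Qed.

Lemma descent_cubic :
  level7_numer q x y x7 y7 (f + 4 * g) = 2 * x ^+ 11 * x7 ^+ 3 * (y * y7) ^+ 4 ->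
  (f + 4 * g) ^+ 3 * (x * x7) =
  x ^+ 8 + 13 * q * x ^+ 4 * x7 ^+ 4 + 49 * q ^+ 2 * x7 ^+ 8.
Proof.
move/(congr1 tof).
move: tH1 tH7 tHfg tnz1 tnz2 tnz3; rewrite /level14_numu /level14_numS /level14_den.
rewrite /level7_numer !tofE => h1 h7 hfg h2 h3 h4 h5.
apply: tinj; rewrite !tofE.
rewrite tfE tgE ?tf2E ?tg2E in hfg h2 h4 h5 *.
exact: (spec_cubic (tn q0) (tn x0) (tn y0) (tn w0) (tn x70) (tn y70) (tn w70)).
Qed.

End DescentDomain.

(** * The series f, g and z in terms of Euler products *)

Section Level7Cubic.
Variable K : numFieldType.
Local Notation X := (fpsX K).
Local Notation dil := fps_dil.
Local Notation e n := (dil n (eulerS K)).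

Let x := eulerS K. Let y := e 2. Let w := e 4. Let v := e 8.
Let x7 := e 7. Let y7 := e 14. Let w7 := e 28.

Lemma dil_euler_neq0 n : e n != 0.
Proof. by apply: fps_neq0_coef0; rewrite fcoef_dil0 eulerS_coef0 oner_eq0. Qed.

Lemma euler_neq0 : x != 0.
Proof. by apply: fps_neq0_coef0; rewrite eulerS_coef0 oner_eq0. Qed.

Lemma phiMS_dil n : (0 < n)%N -> dil n (phiMS K) * e (n * 2) = (e n) ^+ 2.
Proof.
by move=> n0; rewrite -fps_dilM // -rmorphM /= phiMS_euler rmorphXn.
Qed.

Lemma psiS_dil n : (0 < n)%N -> dil n (psiS K) * e n = e (n * 2) ^+ 2.
Proof.
by move=> n0; rewrite -fps_dilM // -rmorphM /= psiS_euler rmorphXn.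
Qed.

Lemma euler_jacobi :
  y ^+ 24 = x ^+ 16 * w ^+ 8 + 16 * X * x ^+ 8 * w ^+ 16.
Proof.
apply: (@jacobi_domain _ X x y w v (phiMS K) (dil 2 (phiMS K)) (dil 4 (phiMS K))
  (phiS K) (dil 2 (phiS K)) (dil 4 (psiS K))).
- exact: natr_fps_neq0.
- exact: euler_neq0.
1-3: exact: dil_euler_neq0.
- exact: phiMS_euler.
- exact: (phiMS_dil (n := 2)).
- exact: (phiMS_dil (n := 4)).
- exact: (psiS_dil (n := 4)).
- exact: phiS_mul_phiMS.
- by rewrite -rmorphM /= phiS_mul_phiMS rmorphXn /= fps_dilM.
- exact: phiS_sq_add.
- exact: phiS_sq_sub.
Qed.

Let f := phi2S K. Let g := psi2S K.

Lemma phi2S_euler : f * (y * y7) = x ^+ 2 * x7 ^+ 2.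
Proof. by rewrite /f /phi2S mulrACA phiMS_euler (phiMS_dil (n := 7)). Qed.

Lemma psi2S_euler : g * (x * x7) = X * (y ^+ 2 * y7 ^+ 2).
Proof.
have -> : g * (x * x7) = X * ((psiS K * x) * (dil 7 (psiS K) * x7)).
  by rewrite /g /psi2S; ring.
by rewrite psiS_euler (psiS_dil (n := 7)).
Qed.

Lemma qformSE : qformS K = f + 4 * g.
Proof.
have := qformS_sub K; have := qformS_add K; rewrite -/f -/g => h1 h2.
have -> : qformS K = 2 * (qformS K - dil 2 (qformS K)) + 2 * dil 2 (qformS K) - qformS K.
  by ring.
by rewrite h2 -h1; ring.
Qed.

Lemma dil_qformSE : dil 2 (qformS K) = f + 2 * g.
Proof.
have := qformS_sub K; rewrite -/g => h.
have -> : dil 2 (qformS K) = qformS K - (qformS K - dil 2 (qformS K)) by ring.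
by rewrite h qformSE; ring.
Qed.

Lemma phi2S_coef0 : f.@[0] = 1.
Proof.
have := congr1 (fun G => G.@[0]) phi2S_euler.
rewrite !fcoef0M /x /y /y7 /x7 !fcoef_dil0 eulerS_coef0.
by rewrite !mulr1.
Qed.

Lemma psi2S_coef0 : g.@[0] = 0.
Proof. by rewrite /g /psi2S -mulrA fcoefXM. Qed.

End Level7Cubic.

Section Transport.
Variables (D D' : comNzRingType) (d : {rmorphism D -> D'}).

Lemma rmorph_jacobi (q x y w : D) :
  y ^+ 24 = x ^+ 16 * w ^+ 8 + 16 * q * x ^+ 8 * w ^+ 16 ->
  d y ^+ 24 = d x ^+ 16 * d w ^+ 8 + 16 * d q * d x ^+ 8 * d w ^+ 16.
Proof.
by move/(congr1 d); rewrite !(rmorph_nat, rmorphXn, rmorphM, rmorphD).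
Qed.

Lemma rmorph_phi (f a b x y : D) : f * (a * b) = x ^+ 2 * y ^+ 2 ->
  d f * (d a * d b) = d x ^+ 2 * d y ^+ 2.
Proof. by move/(congr1 d); rewrite !(rmorphXn, rmorphM). Qed.

Lemma rmorph_psi (q f a b x y : D) : f * (a * b) = q * (x ^+ 2 * y ^+ 2) ->
  d f * (d a * d b) = d q * (d x ^+ 2 * d y ^+ 2).
Proof. by move/(congr1 d); rewrite !(rmorphXn, rmorphM). Qed.

Lemma level7_numer_rmorph (q x y x7 y7 z : D) :
  d (level7_numer q x y x7 y7 z) =
  level7_numer (d q) (d x) (d y) (d x7) (d y7) (d z).
Proof.
by rewrite /level7_numer !(rmorph_nat, rmorphXn, rmorphM, rmorphB, rmorphD).
Qed.

Lemma rmorph_den (x x7 y y7 : D) :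
  d (2 * x ^+ 11 * x7 ^+ 3 * (y * y7) ^+ 4) =
  2 * d x ^+ 11 * d x7 ^+ 3 * (d y * d y7) ^+ 4.
Proof. by rewrite !(rmorph_nat, rmorphXn, rmorphM). Qed.

Lemma rmorph_add4 (f g : D) : d (f + 4 * g) = d f + 4 * d g.
Proof. by rewrite !(rmorph_nat, rmorphM, rmorphD). Qed.

(** The factor a^2 + a b + b^2 - 3 of [mod_cubic] with denominators cleared. Being polynomial, it
    commutes with the constant coefficient, which is how it is seen to be nonzero. *)
Definition level14_gap (R : pzRingType) (q x y x7 y7 : R) : R :=
  level14_numS q x y x7 y7 ^+ 2 +
  level14_numS q x y x7 y7 * level14_numu q x y x7 y7 +
  level14_numu q x y x7 y7 ^+ 2 - 3 * level14_den q x y x7 y7 ^+ 2.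

Lemma level14_gap_rmorph (q x y x7 y7 : D) :
  d (level14_gap q x y x7 y7) =
  level14_gap (d q) (d x) (d y) (d x7) (d y7).
Proof.
rewrite /level14_gap /level14_numS /level14_numu /level14_den.
by rewrite !(rmorph_nat, rmorphXn, rmorphM, rmorphB, rmorphD).
Qed.

End Transport.

Section ConstantCoefficient.
Variable K : fieldType.

Definition fps_cst (F : fps K) : K := F.@[0].

Fact fps_cst_is_zmod : zmod_morphism fps_cst.
Proof. by []. Qed.

Fact fps_cst_is_monoid : monoid_morphism fps_cst.
Proof. by split => // F G; rewrite /fps_cst fcoef0M. Qed.

HB.instance Definition _ :=
  GRing.isZmodMorphism.Build _ _ fps_cst fps_cst_is_zmod.
HB.instance Definition _ :=
  GRing.isMonoidMorphism.Build _ _ fps_cst fps_cst_is_monoid.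

End ConstantCoefficient.


(** * The cubic for formal power series *)

Section Cubic.
Variable K : numFieldType.
Local Notation X := (fpsX K).
Local Notation dil := fps_dil.
Local Notation e n := (dil n (eulerS K)).
Local Notation x := (eulerS K).

Lemma euler_jacobi_dil7 :
  e 14 ^+ 24 = e 7 ^+ 16 * e 28 ^+ 8 + 16 * X ^+ 7 * e 7 ^+ 8 * e 28 ^+ 16.
Proof.
have := rmorph_jacobi (dil 7) (euler_jacobi K).
by rewrite /= !fps_dilM // fps_dilX.
Qed.

Lemma qformS_cubic : qformS K ^+ 3 * (x * e 7) =
  x ^+ 8 + 13 * X * x ^+ 4 * e 7 ^+ 4 + 49 * X ^+ 2 * e 7 ^+ 8.
Proof.
have x0 := euler_neq0 K.
have X0 := fpsX_neq0 K.
have e0 n := dil_euler_neq0 K n.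
have fE := phi2S_euler K.
have gE := psi2S_euler K.
have f2E : dil 2 (phi2S K) * (e 4 * e 28) = e 2 ^+ 2 * e 14 ^+ 2.
  by have := rmorph_phi (dil 2) fE; rewrite /= !fps_dilM.
have g2E : dil 2 (psi2S K) * (e 2 * e 14) = X ^+ 2 * (e 4 ^+ 2 * e 28 ^+ 2).
  by have := rmorph_psi (dil 2) gE; rewrite /= !fps_dilM // fps_dilX.
have z2E : dil 2 (qformS K) = dil 2 (phi2S K) + 4 * dil 2 (psi2S K).
  by rewrite qformSE; apply: (rmorph_add4 (dil 2)).
have Hfg : dil 2 (phi2S K) + 4 * dil 2 (psi2S K) = phi2S K + 2 * psi2S K.
  by rewrite -z2E dil_qformSE.
have c0 := eulerS_coef0 K.
have fc := phi2S_coef0 K.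
have gc := psi2S_coef0 K.
have Xc : X.@[0] = 0 by [].
have coefs := (fc, gc, c0, Xc, fcoef_dil0, fcoef1, fcoefMn, fcoef0X, fcoef0M, fcoefB, fcoefD).
have nz1 : dil 2 (phi2S K) - 2 * psi2S K != 0.
  by apply: fps_neq0_coef0; rewrite !coefs mulr0 subr0 oner_eq0.
pose c : {rmorphism fps K -> K} := @fps_cst K.
pose d : {rmorphism fps K -> fps K} := dil 2.
have cx : c x = 1 := c0.
have ce n : c (e n) = 1 by rewrite -[LHS]/((e n).@[0]) fcoef_dil0.
have cX : c X = 0 by [].
have cz : c (phi2S K + 4 * psi2S K) = 1.
  by rewrite -[LHS]/((phi2S K + 4 * psi2S K).@[0]) !coefs mulr0 addr0.
have nz2 : level14_gap X x (e 2) (e 7) (e 14) != 0.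
  apply: fps_neq0_coef0; rewrite -[_.@[0]]/(c _) (level14_gap_rmorph c).
  rewrite cX cx !ce (_ : level14_gap _ _ _ _ _ = 3) ?pnatr_eq0 //.
  by rewrite /level14_gap /level14_numS /level14_numu /level14_den; ring.
have nz3 : dil 2 (phi2S K) ^+ 8 - (dil 2 (phi2S K) - phi2S K) ^+ 8 != 0.
  by apply: fps_neq0_coef0; rewrite !coefs subrr expr0n expr1n subr0 oner_eq0.
have two0 : (2 : fps K) != 0 := natr_fps_neq0 K 1.
have H1 := euler_jacobi K.
have H7 := euler_jacobi_dil7.
have ratio := descent_ratio X0 x0 (e0 2) (e0 4) (e0 7) (e0 14) (e0 28) fE gE f2E
  g2E two0 H1 H7 Hfg nz1 nz2 nz3.
rewrite qformSE.
apply: (descent_cubic X0 x0 (e0 2) (e0 4) (e0 7) (e0 14) (e0 28) fE gE f2E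
  g2E two0 H1 H7 Hfg nz1 nz2 nz3).
have cden : c (2 * x ^+ 11 * e 7 ^+ 3 * (e 2 * e 14) ^+ 4) = 2.
  by rewrite (rmorph_den c) cx !ce !(expr1n, mulr1).
(* Both series start with 2. This is where the sign in T matters: with -(S - 1/S) the numerator
   would start with 0. *)
apply: fps_dil_ratio; rewrite -?[_.@[0]]/(c _) ?cden ?pnatr_eq0 //.
  by rewrite (level7_numer_rmorph c) cX cx !ce cz /level7_numer; ring.
rewrite -![fps_dil 2 _]/(d _) (rmorph_den d) (level7_numer_rmorph d) (rmorph_add4 d).
have -> : d X = X ^+ 2 by exact: fps_dilX.
have dE n : d (e n) = e (2 * n) by exact: fps_dilM.
rewrite !dE; exact: ratio.
Qed.

End Cubic.

(** * Evaluation in the unit disc *)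

Local Open Scope complex_scope.

(* The norm topology is attached to numFieldType structures, not to the bare
   type R[i]. *)
Definition complexField (R : realType) : numFieldType := R[i].

Section Evaluation.
Variable R : realType.
Local Notation C := (complexField R).
Local Notation normc := (@Normc.normc R).

Lemma normc_ge0 (z : C) : 0 <= normc z.
Proof. by rewrite -lecR; exact: (@normr_ge0 _ R[i] z). Qed.

Lemma normcX (z : C) n : normc (z ^+ n) = normc z ^+ n.
Proof.
elim: n => [|n IH]; first by rewrite !expr0 Normc.normc1.
by rewrite !exprS Normc.normcM IH.
Qed.

Lemma normcD_le (y z : C) : normc (y + z) <= normc y + normc z.
Proof. by rewrite -lecR rmorphD; exact: (@ler_normD _ R[i]). Qed.

Lemma normcN_eq (z : C) : normc (- z) = normc z.
Proof. by apply: (@complexI R); exact: (@normrN _ R[i]). Qed.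

Lemma normc_sum I (s : seq I) (F : I -> C) :
  normc (\sum_(i <- s) F i) <= \sum_(i <- s) normc (F i).
Proof.
elim: s => [|i s IH]; first by rewrite !big_nil Normc.normc0.
by rewrite !big_cons (le_trans (normcD_le _ _)) // lerD2l.
Qed.

Lemma cvg_normc (u : nat -> C) (a : C) :
  normc (u n - a) @[n --> \oo] --> 0 -> u n @[n --> \oo] --> a.
Proof.
move=> ua; apply/cvgrPdist_lt => -[e e'].
(* A positive element of R[i] has zero imaginary part, so the radius is real. *)
rewrite ltcE /= => /andP [/eqP -> e0].
have /cvgrPdist_lt /(_ _ e0) := ua.
apply: filterS => n; rewrite sub0r normrN ger0_norm ?normc_ge0 // => h.
by rewrite distrC -[`|_|]/((normc _)%:C) ltcR.
Qed.

Lemma cvg_geometric_bound (u : nat -> R) (B t : R) : 0 <= t < 1 ->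
  (forall n, 0 <= u n <= B * t ^+ n) -> u n @[n --> \oo] --> 0.
Proof.
move=> /andP [t0 t1] uB.
apply: (@squeeze_cvgr _ _ _ _ (fun=> 0) (fun n => B * t ^+ n)).
- by apply: nearW.
- exact: cvg_cst.
rewrite -[X in _ --> X](mulr0 B); apply: cvgMr.
by apply: cvg_expr; rewrite ger0_norm.
Qed.

(** Completeness is drawn from R: real and imaginary parts have absolutely summable increments. *)
Lemma cvg_geometric_steps (u : nat -> C) (B t : R) : 0 <= t < 1 ->
  (forall n, normc (u n.+1 - u n) <= B * t ^+ n) ->
  exists a : C, u n @[n --> \oo] --> a.
Proof.
move=> t01 uB.
have real_cvg (v : nat -> R) :
    (forall n, `|v n.+1 - v n| <= B * t ^+ n) -> cvgn v.
  move=> vB; have vE : v = (fun n => v 0 + series (fun k => v k.+1 - v k) n).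
    apply/funext => n; rewrite /series /= telescope_sumr //; first by rewrite addrC subrK.
  rewrite vE; apply: is_cvgD; first exact: is_cvg_cst.
  apply: normed_cvg; apply: (series_le_cvg _ _ vB) => n //.
    exact: le_trans (vB n).
  case/andP: t01 => t0 t1.
  by apply: is_cvg_geometric_series; rewrite ger0_norm.
have B0 n := le_trans (normc_ge0 _) (uB n).
have re_le (z : C) : `|complex.Re z| <= normc z.
  by case: z => x y /=; rewrite -sqrtr_sqr ler_wsqrtr // lerDl sqr_ge0.
have im_le (z : C) : `|complex.Im z| <= normc z.
  by case: z => x y /=; rewrite -sqrtr_sqr ler_wsqrtr // lerDr sqr_ge0.
have le_reim (z : C) : normc z <= `|complex.Re z| + `|complex.Im z|.
  case: z => x y /=; rewrite -[leRHS]ger0_norm ?addr_ge0 // -sqrtr_sqr.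
  apply: ler_wsqrtr; rewrite sqrrD !real_normK ?num_real // addrAC lerDl.
  by rewrite mulrn_wge0 // mulr_ge0.
pose a : C := Complex (limn (fun n => complex.Re (u n)))
                      (limn (fun n => complex.Im (u n))).
exists a; apply: cvg_normc.
have cRe : (complex.Re (u n) @[n --> \oo] --> complex.Re a).
  apply: real_cvg => n; apply: le_trans (uB n); apply: le_trans (re_le _).
  by case: (u n.+1) (u n) => ? ? [? ?].
have cIm : (complex.Im (u n) @[n --> \oo] --> complex.Im a).
  apply: real_cvg => n; apply: le_trans (uB n); apply: le_trans (im_le _).
  by case: (u n.+1) (u n) => ? ? [? ?].
apply: (@squeeze_cvgr _ _ _ _ (fun=> 0) (fun n =>
  `|complex.Re (u n) - complex.Re a| + `|complex.Im (u n) - complex.Im a|)).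
- apply: nearW => n; rewrite normc_ge0 /= (le_trans (le_reim _)) //.
  by case: (u n).
- exact: cvg_cst.
rewrite -[X in _ --> X](addr0 0); apply: cvgD.
all: by apply/norm_cvg0P/subr_cvg0.
Qed.
End Evaluation.

Section SequenceLimits.
Variables (K : numFieldType) (u v : nat -> K) (a b : K).

Lemma seq_cvgD : u n @[n --> \oo] --> a -> v n @[n --> \oo] --> b ->
  u n + v n @[n --> \oo] --> a + b.
Proof. exact: cvgD. Qed.

Lemma seq_cvgB : u n @[n --> \oo] --> a -> v n @[n --> \oo] --> b ->
  u n - v n @[n --> \oo] --> a - b.
Proof. exact: cvgB. Qed.

Lemma seq_cvgM : u n @[n --> \oo] --> a -> v n @[n --> \oo] --> b ->
  u n * v n @[n --> \oo] --> a * b.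
Proof. exact: cvgM. Qed.

Lemma seq_cvgN : u n @[n --> \oo] --> a -> - u n @[n --> \oo] --> - a.
Proof. exact: cvgN. Qed.

Lemma seq_cvg_cst : a @[n --> \oo] --> a.
Proof. exact: cvg_cst. Qed.

Lemma seq_cvg_unique : u n @[n --> \oo] --> a -> u n @[n --> \oo] --> b -> a = b.
Proof. exact: norm_cvg_unique. Qed.

Lemma seq_cvg_lim : u n @[n --> \oo] --> a -> lim (u n @[n --> \oo]) = a.
Proof. exact: (cvg_lim (@norm_hausdorff _ _)). Qed.

Lemma seq_cvg_shift : u n.+1 @[n --> \oo] --> a -> u n @[n --> \oo] --> a.
Proof. by move=> ua; rewrite -cvg_shiftS. Qed.

Lemma seq_cvgS : u n @[n --> \oo] --> a -> u n.+1 @[n --> \oo] --> a.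
Proof. by move=> ua; rewrite cvg_shiftS. Qed.

Lemma eq_seq_cvg : u =1 v -> u n @[n --> \oo] --> a -> v n @[n --> \oo] --> a.
Proof. by move=> /funext ->. Qed.

End SequenceLimits.

(** * Evaluating power series through majorized polynomials *)

Section Approximation.
Variable R : realType.
Local Notation C := (complexField R).
Local Notation normc := (@Normc.normc R).

Definition fps_of_poly (p : {poly C}) : fps C := Fps (fun n => p`_n).

Definition majorized (p : {poly C}) (P : {poly R}) :=
  forall n, normc p`_n <= P`_n.

Lemma majorizedD p P p' P' : majorized p P -> majorized p' P' ->
  majorized (p + p') (P + P').
Proof.
by move=> h h' n; rewrite !coefD (le_trans (normcD_le _ _)) // lerD.
Qed.

Lemma majorizedN p P : majorized p P -> majorized (- p) P.
Proof. by move=> h n; rewrite coefN normcN_eq. Qed.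

Lemma majorizedM p P p' P' : majorized p P -> majorized p' P' ->
  majorized (p * p') (P * P').
Proof.
move=> h h' n; rewrite !coefM (le_trans (normc_sum _ _)) // ler_sum // => i _.
by rewrite Normc.normcM ler_pM // normc_ge0.
Qed.

Lemma majorizedC (c : C) : majorized c%:P (normc c)%:P.
Proof. by move=> n; rewrite !coefC; case: eqP; rewrite // Normc.normc0. Qed.

Lemma majorizedXn k : majorized 'X^k 'X^k.
Proof.
by move=> n; rewrite !coefXn; case: eqP; rewrite (Normc.normc0, Normc.normc1).
Qed.

Lemma majorized_comp p P k : (0 < k)%N -> majorized p P ->
  majorized (p \Po 'X^k) (P \Po 'X^k).
Proof.
move=> k0 h n; rewrite !coef_comp_poly_Xn //; case: ifP => // _.
by rewrite Normc.normc0.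
Qed.

Lemma majorized_coef_ge0 p P n : majorized p P -> 0 <= P`_n.
Proof. by move=> h; apply: le_trans (h n); apply: normc_ge0. Qed.

Lemma majorized_horner_ge0 p P s : majorized p P -> 0 <= s -> 0 <= P.[s].
Proof.
move=> h s0; rewrite horner_coef sumr_ge0 // => i _.
by rewrite mulr_ge0 ?exprn_ge0 // (majorized_coef_ge0 _ h).
Qed.

(** For i >= N one has |q|^i = s^i (|q| / s)^i <= s^i (|q| / s)^N: vanishing to order N is traded
    for geometric decay by moving to a larger radius s. *)
Lemma majorized_tail p P (q : C) (s : R) N : majorized p P ->
  (forall n, (n < N)%N -> p`_n = 0) -> 0 < s -> normc q <= s ->
  normc p.[q] <= P.[s] * (normc q / s) ^+ N.
Proof.
move=> h pN s0 qs; set r := normc q; set M := maxn (size p) (size P).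
have t0 : 0 <= r / s by rewrite divr_ge0 ?normc_ge0 // ltW.
have t1 : r / s <= 1 by rewrite ler_pdivrMr // mul1r.
rewrite (@horner_coef_wide _ M) ?leq_maxl // (@horner_coef_wide _ M P) ?leq_maxr //.
rewrite (le_trans (normc_sum _ _)) // mulr_suml ler_sum // => i _.
rewrite Normc.normcM normcX -/r.
have [iN|Ni] := ltnP i N.
  rewrite pN // Normc.normc0 mul0r !mulr_ge0 ?exprn_ge0 //; last exact: ltW.
  exact: majorized_coef_ge0 h.
rewrite -mulrA ler_pM ?normc_ge0 ?exprn_ge0 ?normc_ge0 //.
have -> : r ^+ i = s ^+ i * (r / s) ^+ i.
  by rewrite -exprMn mulrCA mulfV ?mulr1 // gt_eqF.
rewrite ler_pM2l ?exprn_gt0 //.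
exact: ler_wiXn2l.
Qed.

(* The l^1 bound uniform in N makes evaluation multiplicative without any Cauchy
   product of infinite series. *)
Definition approx (p : nat -> {poly C}) (F : fps C) :=
  (forall N, fps_eqmod N (fps_of_poly (p N)) F) /\
  (forall s : R, 0 <= s < 1 ->
     exists B : R, forall N, exists2 P, majorized (p N) P & P.[s] <= B).

Lemma approxD p p' F F' : approx p F -> approx p' F' ->
  approx (fun N => p N + p' N) (F + F').
Proof.
move=> [h b] [h' b']; split=> [N n nN|s s01].
  by rewrite fcoefD -(h N) // -(h' N) //= coefD.
have [B bB] := b s s01; have [B' bB'] := b' s s01; exists (B + B') => N.
have [P mP PB] := bB N; have [P' mP' PB'] := bB' N.
by exists (P + P'); [exact: majorizedD | rewrite hornerD lerD].
Qed.

Lemma approxN p F : approx p F -> approx (fun N => - p N) (- F).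
Proof.
move=> [h b]; split=> [N n nN|s s01]; first by rewrite fcoefN -(h N) //= coefN.
have [B bB] := b s s01; exists B => N; have [P mP PB] := bB N.
by exists P => //; apply: majorizedN.
Qed.

Lemma approxM p p' F F' : approx p F -> approx p' F' ->
  approx (fun N => p N * p' N) (F * F').
Proof.
move=> [h b] [h' b']; split=> [N|s s01].
  have e : fps_of_poly (p N * p' N) = fps_of_poly (p N) * fps_of_poly (p' N).
    by apply: fpsP => n; rewrite fcoefM /= coefM.
  by rewrite e; apply: fps_eqmodM; [apply: h | apply: h'].
have s0 : 0 <= s by case/andP: s01.
have [B bB] := b s s01; have [B' bB'] := b' s s01; exists (B * B') => N.
have [P mP PB] := bB N; have [P' mP' PB'] := bB' N.
exists (P * P'); first exact: majorizedM.
rewrite hornerM; apply: ler_pM => //; exact: majorized_horner_ge0.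
Qed.

Lemma approx_one : approx (fun=> 1) 1.
Proof.
split=> [N n nN|s s01]; first by rewrite /= coef1.
exists 1 => N; exists 1; last by rewrite hornerC.
by move=> n; rewrite !coef1; case: eqP; rewrite (Normc.normc0, Normc.normc1).
Qed.

Lemma approxX : approx (fun=> 'X) (fpsX C).
Proof.
split=> [N n nN|s /andP [s0 s1]]; first by rewrite /= coefX.
exists 1 => N; exists 'X; last by rewrite hornerX ltW.
by rewrite -['X]expr1; exact: majorizedXn.
Qed.

Lemma approx_dil p F k : (0 < k)%N -> approx p F ->
  approx (fun N => p N \Po 'X^k) (fps_dil k F).
Proof.
move=> k0 [h b]; split=> [N n nN|s /andP [s0 s1]].
  rewrite /= coef_comp_poly_Xn //; case: ifP => // _; apply: h.
  exact: leq_ltn_trans (leq_div _ _) nN.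
have sk : 0 <= s ^+ k < 1 by rewrite exprn_ge0 //= exprn_ilt1 // -lt0n.
have [B bB] := b _ sk; exists B => N; have [P mP PB] := bB N.
exists (P \Po 'X^k); first exact: majorized_comp.
by rewrite horner_comp hornerXn.
Qed.

Lemma disc_radius (q : C) : normc q < 1 ->
  exists2 s : R, 0 < s < 1 & normc q < s.
Proof.
move=> q1; exists ((1 + normc q) / 2); have := normc_ge0 q; last by lra.
by move=> ?; apply/andP; split; lra.
Qed.

Lemma approx_dist p p' F (q : C) : normc q < 1 -> approx p F -> approx p' F ->
  exists B t : R, [/\ 0 <= t < 1,
    forall N, normc ((p N).[q] - (p' N).[q]) <= B * t ^+ N &
    forall N, normc ((p N.+1).[q] - (p N).[q]) <= B * t ^+ N].
Proof.
move=> q1 [h b] [h' b']; have [s /andP [s0 s1] qs] := disc_radius q1.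
have s01 : 0 <= s < 1 by rewrite ltW.
have [B bB] := b s s01; have [B' bB'] := b' s s01.
have t0 : 0 <= normc q / s by rewrite divr_ge0 ?normc_ge0 // ltW.
have key (f g : {poly C}) (B1 B2 : R) N : (forall n, (n < N)%N -> f`_n = g`_n) ->
    (exists2 P, majorized f P & P.[s] <= B1) ->
    (exists2 P, majorized g P & P.[s] <= B2) ->
    normc (f.[q] - g.[q]) <= (B1 + B2) * (normc q / s) ^+ N.
  move=> fg [P mP PB] [P' mP' PB']; rewrite -hornerN -hornerD.
  have mD := majorizedD mP (majorizedN mP').
  have mN n : (n < N)%N -> (f - g)`_n = 0.
    by move=> nN; rewrite coefD coefN (fg n nN) subrr.
  apply: le_trans (majorized_tail mD mN s0 (ltW qs)) _.
  by rewrite ler_wpM2r ?exprn_ge0 // hornerD lerD.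
(* One constant for both estimates: B + B' compares p with p', and B + B compares consecutive terms
   of p. *)
exists (B + Num.max B B'), (normc q / s); split.
- by rewrite t0 /= ltr_pdivrMr // mul1r.
- move=> N; apply: key => //.
    by move=> n nN; have := h N n nN; have := h' N n nN => /= -> ->.
  by have [P mP PB] := bB' N; exists P => //; rewrite le_max PB orbT.
- move=> N; apply: key => //.
    move=> n nN; have := h N n nN; have := h N.+1 n (leqW nN) => /= -> ->.
    by [].
  by have [P mP PB] := bB N; exists P => //; rewrite le_max PB.
Qed.

(** A relation rather than a function: ring operations carry over without choosing a value, and
    uniqueness holds inside the disc. *)
Definition evaluates (F : fps C) (q a : C) :=
  exists2 p, approx p F & (p N).[q] @[N --> \oo] --> a.

Lemma evaluates_unique F (q a b : C) : normc q < 1 ->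
  evaluates F q a -> evaluates F q b -> a = b.
Proof.
move=> q1 [p ap pa] [p' ap' pb].
have [B [t [t01 d _]]] := approx_dist q1 ap ap'.
have pp0 : (p N).[q] - (p' N).[q] @[N --> \oo] --> (0 : C).
  apply: cvg_normc; apply: (@cvg_geometric_bound _ _ B t t01) => n.
  by rewrite normc_ge0 subr0 d.
have ab := @seq_cvgB C _ _ _ _ pa pb.
apply/eqP; rewrite -subr_eq0; apply/eqP.
exact: (@seq_cvg_unique C _ _ _ ab pp0).
Qed.

Lemma evaluates_exists p F (q : C) : normc q < 1 -> approx p F ->
  exists2 a, evaluates F q a & (p N).[q] @[N --> \oo] --> a.
Proof.
move=> q1 ap; have [B [t [t01 _ d]]] := approx_dist q1 ap ap.
have [a pa] := cvg_geometric_steps t01 d.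
by exists a => //; exists p.
Qed.

Lemma evaluatesD F G q a b : evaluates F q a -> evaluates G q b ->
  evaluates (F + G) q (a + b).
Proof.
move=> [p ap pa] [p' ap' pb]; exists (fun N => p N + p' N); first exact: approxD.
apply: (@eq_seq_cvg C (fun N => (p N).[q] + (p' N).[q])) => [N|]; first by rewrite hornerD.
exact: (@seq_cvgD C _ _ _ _ pa pb).
Qed.

Lemma evaluatesN F q a : evaluates F q a -> evaluates (- F) q (- a).
Proof.
move=> [p ap pa]; exists (fun N => - p N); first exact: approxN.
apply: (@eq_seq_cvg C (fun N => - (p N).[q])) => [N|]; first by rewrite hornerN.
exact: (@seq_cvgN C _ _ pa).
Qed.

Lemma evaluatesM F G q a b : evaluates F q a -> evaluates G q b ->
  evaluates (F * G) q (a * b).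
Proof.
move=> [p ap pa] [p' ap' pb]; exists (fun N => p N * p' N); first exact: approxM.
apply: (@eq_seq_cvg C (fun N => (p N).[q] * (p' N).[q])) => [N|]; first by rewrite hornerM.
exact: (@seq_cvgM C _ _ _ _ pa pb).
Qed.

Lemma evaluates1 q : evaluates 1 q 1.
Proof.
exists (fun=> 1); first exact: approx_one.
apply: (@eq_seq_cvg C (fun N => 1)) => [N|]; first by rewrite hornerC.
exact: (@seq_cvg_cst C).
Qed.

Lemma evaluates_nat n q : evaluates n%:R q n%:R.
Proof.
elim: n => [|n IH]; last by rewrite !mulrS; apply: evaluatesD (evaluates1 q) IH.
by rewrite -[0%:R](subrr 1) -[X in evaluates _ _ X](subrr 1);
  apply: evaluatesD (evaluates1 q) (evaluatesN (evaluates1 q)).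
Qed.

Lemma evaluates_expr F q a n : evaluates F q a -> evaluates (F ^+ n) q (a ^+ n).
Proof.
move=> Fa; elim: n => [|n IH]; first by rewrite !expr0; apply: evaluates1.
by rewrite !exprS; apply: evaluatesM.
Qed.

Lemma evaluatesX q : evaluates (fpsX C) q q.
Proof.
exists (fun=> 'X); first exact: approxX.
apply: (@eq_seq_cvg C (fun N => q)) => [N|]; first by rewrite hornerX.
exact: (@seq_cvg_cst C).
Qed.

Lemma evaluates_dil F q a k : (0 < k)%N -> evaluates F (q ^+ k) a ->
  evaluates (fps_dil k F) q a.
Proof.
move=> k0 [p ap pa]; exists (fun N => p N \Po 'X^k); first exact: approx_dil.
apply: (@eq_seq_cvg C (fun N => (p N).[q ^+ k])) => [N|]; first by rewrite horner_comp hornerXn.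
exact: pa.
Qed.

End Approximation.

(** * The values of E, phi and psi *)

Section EvaluateTheta.
Variable R : realType.
Local Notation C := (complexField R).
Local Notation normc := (@Normc.normc R).

Lemma sum_geometric_le (s : R) m n : 0 <= s < 1 ->
  \sum_(m <= k < n) s ^+ k <= (1 - s)^-1.
Proof.
move=> /andP [s0 s1]; have s10 : 0 < 1 - s by lra.
apply: (@le_trans _ _ (\sum_(0 <= k < n) s ^+ k)).
  have [mn|nm] := leqP m n; last first.
    by rewrite big_geq ?sumr_ge0 // 1?ltnW // => i _; apply: exprn_ge0.
  by rewrite [leRHS](@big_cat_nat _ _ _ m) //= lerDr sumr_ge0 // => i _; apply: exprn_ge0.
have e : (1 - s) * \sum_(0 <= k < n) s ^+ k = 1 - s ^+ n.
  elim: n => [|n IH]; first by rewrite big_geq // mulr0 expr0 subrr.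
  by rewrite big_nat_recr //= mulrDr IH exprS; ring.
rewrite -[leRHS]mulr1 ler_pdivlMl // e gerBl; exact: exprn_ge0.
Qed.

Lemma prod_le_expR (F G : nat -> R) m n :
  (forall k, (m <= k)%N -> 0 <= F k <= expR (G k)) ->
  \prod_(m <= k < n) F k <= expR (\sum_(m <= k < n) G k).
Proof.
move=> h; elim: n => [|n IH]; first by rewrite !big_geq // expR0.
have [mn|nm] := leqP m n; last by rewrite !big_geq // expR0.
rewrite !big_nat_recr //= expRD; have /andP [F0 FG] := h n mn.
apply: ler_pM => //; rewrite big_nat_cond prodr_ge0 // => k /andP [/andP [mk _] _].
by case/andP: (h k mk).
Qed.

Definition euler_poly N : {poly C} := \prod_(1 <= k < N.+1) (1 - 'X^k).

Lemma fps_of_polyM (p p' : {poly C}) :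
  fps_of_poly (p * p') = fps_of_poly p * fps_of_poly p'.
Proof. by apply: fpsP => n; rewrite fcoefM /= coefM. Qed.

Lemma fps_of_poly_euler N : fps_of_poly (euler_poly N) = eulerP C N.
Proof.
rewrite /euler_poly /eulerP; elim: N => [|N IH].
  by rewrite !big_geq //; apply: fpsP => n; rewrite /= coef1.
rewrite !(@big_nat_recr _ _ _ N.+1 1) //= fps_of_polyM IH; congr (_ * _).
by apply: fpsP => n; rewrite fcoefB fcoefXn fcoef1 /= coefB coefXn coef1.
Qed.

(** The majorant, the product of the 1 + X^k, is at most exp(s + s^2 + ...) at s, because 1 + x <=
    exp x. *)
Lemma approx_euler : approx euler_poly (eulerS C).
Proof.
split=> [N n nN|s s01].
  by rewrite fps_of_poly_euler (@fps_eqmod_eulerP C N) // ltnS ltnW.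
exists (expR (1 - s)^-1) => N; exists (\prod_(1 <= k < N.+1) (1 + 'X^k)).
  rewrite /euler_poly; elim: N => [|N IH].
    rewrite !big_geq // -!polyC1.
    by have := @majorizedC R 1; rewrite Normc.normc1.
  rewrite !(@big_nat_recr _ _ _ N.+1 1) //=; apply: majorizedM => //.
  apply: majorizedD; last by apply: majorizedN; apply: majorizedXn.
  by rewrite -!polyC1; have := @majorizedC R 1; rewrite Normc.normc1.
rewrite horner_prod; have /andP [s0 s1] := s01.
apply: (@le_trans _ _ (expR (\sum_(1 <= k < N.+1) s ^+ k))).
  apply: prod_le_expR => k _; rewrite hornerD hornerC hornerXn expR_ge1Dx.
  by rewrite addr_ge0 // exprn_ge0.
by rewrite ler_expR sum_geometric_le.
Qed.

Lemma euler_poly_horner N (q : C) :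
  (euler_poly N).[q] = \prod_(1 <= n < N.+1) (1 - q ^+ n).
Proof.
by rewrite horner_prod; apply: eq_bigr => k _; rewrite hornerD hornerN hornerC hornerXn.
Qed.

Lemma evaluates_euler (q : C) : normc q < 1 -> evaluates (eulerS C) q (E q).
Proof.
move=> q1; have [a ea] := evaluates_exists q1 approx_euler.
move/(@eq_seq_cvg C _ _ _ (fun N => euler_poly_horner N q)).
by move/(@seq_cvg_lim C); rewrite /E => ->.
Qed.

(** The partial products stay away from 0: with r = |q|, 1 / |1 - q^k| <= 1 + r^k / (1 - r^k) <=
    exp(r^k / (1 - r)), and the exponents sum to at most c = 1 / (1 - r)^2. *)
Lemma E_neq0 (q : C) : normc q < 1 -> E q != 0.
Proof.
move=> q1; have q0 := normc_ge0 q; set r := normc q in q1 q0.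
have r01 : 0 <= r < 1 by rewrite q0.
have r10 : 0 < 1 - r by lra.
have rk k : (0 < k)%N -> 0 < 1 - r ^+ k.
  by move=> k0; rewrite subr_gt0 exprn_ilt1 // -lt0n.
have [a ea] := evaluates_exists q1 approx_euler.
have -> : a = E q by apply: evaluates_unique q1 ea (evaluates_euler q1).
move=> qa; apply/eqP => E0; rewrite E0 in qa.
have factor k : (0 < k)%N -> 1 - r ^+ k <= normc (1 - q ^+ k).
  move=> k0; rewrite lerBlDr -normcX -[leLHS](@Normc.normc1 R).
  by apply: le_trans (normcD_le _ _); rewrite subrK.
pose c := (1 - r)^-1 / (1 - r).
have normc_prod (N : nat) (F : nat -> C) :
    normc (\prod_(1 <= k < N) F k) = \prod_(1 <= k < N) normc (F k).
  by apply: big_morph; [exact: Normc.normcM | exact: Normc.normc1].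
have bound N : expR (- c) <= normc (euler_poly N).[q].
  rewrite euler_poly_horner normc_prod.
  have pos : 0 < \prod_(1 <= k < N.+1) normc (1 - q ^+ k).
    rewrite big_nat_cond prodr_gt0 // => k /andP [/andP [k0 _] _].
    exact: lt_le_trans (rk k k0) (factor k k0).
  rewrite expRN -[leRHS]invrK lef_pV2 ?posrE ?expR_gt0 ?invr_gt0 //.
  rewrite -prodfV.
  apply: (@le_trans _ _ (expR (\sum_(1 <= k < N.+1) r ^+ k / (1 - r)))).
    apply: prod_le_expR => k k0; rewrite invr_ge0 normc_ge0 /=.
    apply: le_trans (expR_ge1Dx _).
    apply: (@le_trans _ _ (1 - r ^+ k)^-1).
      by rewrite lef_pV2 ?posrE ?rk ?factor // (lt_le_trans (rk k k0)) ?factor.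
    have -> : (1 - r ^+ k)^-1 = 1 + r ^+ k / (1 - r ^+ k).
      by field; rewrite gt_eqF // rk.
    rewrite lerD2l ler_wpM2l ?exprn_ge0 // lef_pV2 ?posrE ?rk //.
    by rewrite lerD2l lerN2 -[leRHS]expr1 ler_wiXn2l // ltW.
  by rewrite ler_expR -mulr_suml ler_wpM2r ?invr_ge0 ?(ltW r10) // sum_geometric_le.
have e0 : 0 < (expR (- c))%:C :> C by rewrite ltcR expR_gt0.
have /cvgrPdist_lt /(_ _ e0) [N _ /(_ N (leqnn N))] := qa.
rewrite /= sub0r normrN -[`|_|]/((normc _)%:C) ltcR.
by rewrite ltNge bound.
Qed.

(** As a j >= j and s < 1, the geometric series dominates, even if exponents repeat. *)
Lemma lacunary_bound (c : nat -> C) (a : nat -> nat) (s : R) N :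
  (forall j, normc (c j) <= 1) -> (forall j, (j <= a j)%N) -> 0 <= s < 1 ->
  exists2 P, majorized (\sum_(0 <= j < N) (c j)%:P * 'X^(a j)) P &
             P.[s] <= (1 - s)^-1.
Proof.
move=> c1 ja s01; exists (\sum_(0 <= j < N) 'X^(a j)).
  move=> n; rewrite !coef_sum (le_trans (normc_sum _ _)) // ler_sum // => j _.
  rewrite coefCM !coefXn; case: eqP => _; first by rewrite mulr1 c1.
  by rewrite mulr0 Normc.normc0.
rewrite horner_sum; apply: le_trans (sum_geometric_le 0 N s01).
have /andP [s0 s1] := s01.
apply: ler_sum => j _; rewrite hornerXn ler_wiXn2l //; exact: ltW.
Qed.

Lemma fps_of_poly_sum (c : nat -> C) (a : nat -> nat) N n :
  (\sum_(0 <= j < N) (c j)%:P * 'X^(a j))`_n =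
  \sum_(0 <= j < N) c j * (n == a j)%:R.
Proof.
by rewrite coef_sum; apply: eq_bigr => j _; rewrite coefCM coefXn.
Qed.

Definition psi_poly N : {poly C} := \sum_(0 <= j < N) 1%:P * 'X^('C(j.+1, 2)).

Lemma approx_psi : approx psi_poly (psiS C).
Proof.
split=> [N n nN|s s01].
  rewrite (@psiS_eqmod C _ _ nN) /= fps_of_poly_sum fcoef_sum.
  by apply: eq_bigr => j _; rewrite mul1r fcoefXn.
exists (1 - s)^-1 => N; apply: lacunary_bound => // j; first by rewrite Normc.normc1.
by rewrite binS bin1 leq_addl.
Qed.

Lemma evaluates_psi (q : C) : normc q < 1 -> evaluates (psiS C) q (psi q).
Proof.
move=> q1; have [a ea] := evaluates_exists q1 approx_psi.
have h N : (psi_poly N).[q] = \sum_(0 <= n < N) q ^+ (n * n.+1)./2.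
  rewrite horner_sum; apply: eq_bigr => j _.
  by rewrite hornerM hornerC mul1r hornerXn bin2 mulnC.
by move/(@eq_seq_cvg C _ _ _ h)/(@seq_cvg_lim C); rewrite /psi => ->.
Qed.

Definition phi_poly N : {poly C} := \sum_(0 <= s < N) ((-1) ^+ s)%:P * 'X^(s * s).

Lemma approx_phi :
  approx (fun N => phi_poly N.+1 + phi_poly N.+1 - 1) (phiMS C).
Proof.
split=> [N n nN|s s01].
  rewrite (@phiMS_eqmod C N n) ?ltnS ?(ltnW nN) //.
  rewrite mulr_natl fcoefB fcoefMn fcoef1 mulr2n fcoef_sum.
  rewrite [LHS]/= coefB coefD coef1 fps_of_poly_sum.
  have sE : \sum_(0 <= i < N.+1) (-1) ^+ i * (n == (i * i)%N)%:R =
    \sum_(0 <= i < N.+1) ((-1) ^+ i * fpsX C ^+ (i * i)).@[n] :> C.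
    apply: eq_bigr => i _; rewrite -[in LHS]signr_odd -[in RHS]signr_odd.
    by case: (odd i); rewrite ?expr1 ?expr0 ?mulN1r ?mul1r ?fcoefN fcoefXn.
  by rewrite sE.
have mono j : (j <= j * j)%N by nia.
have n1 j : normc ((-1) ^+ j) <= 1.
  by rewrite normcX normcN_eq Normc.normc1 expr1n.
exists ((1 - s)^-1 + (1 - s)^-1 + 1) => N.
have [P mP PB] := lacunary_bound N.+1 n1 mono s01.
exists (P + P + 1).
  apply: majorizedD; first exact: majorizedD.
  apply: majorizedN; rewrite -!polyC1.
  by have := @majorizedC R 1; rewrite Normc.normc1.
by rewrite !hornerD hornerC !lerD.
Qed.

Lemma evaluates_phi (q : C) : normc q < 1 -> evaluates (phiMS C) q (phi (- q)).
Proof.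
move=> q1; have [a ea] := evaluates_exists q1 approx_phi.
pose S N : C := \sum_(0 <= n < N) (- q) ^+ (n * n).
have hS N : (phi_poly N).[q] = S N.
  rewrite horner_sum; apply: eq_bigr => j _.
  rewrite hornerM hornerC hornerXn [RHS]exprNn; congr (_ * _).
  by rewrite -signr_odd -[RHS]signr_odd oddM andbb.
have h N : ((phi_poly N.+1 + phi_poly N.+1 - 1).[q] + 1) / 2 = S N.+1.
  by rewrite !hornerD hornerN hornerC hS; field.
(* The approximants fold the two halves into twice the sum over n >= 0, minus 1. So L is the half
   over n >= 0, and the half over n < 0, which lacks the term at 0, is L - 1. *)
move=> pa; pose L : C := (a + 1) / 2.
have SL : S N @[N --> \oo] --> L.
  apply: (@seq_cvg_shift C); apply: (@eq_seq_cvg C _ _ _ h).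
  exact: (@seq_cvgM C _ _ _ _ (@seq_cvgD C _ _ _ _ pa (@seq_cvg_cst C 1))
           (@seq_cvg_cst C 2^-1)).
have SL1 : S N.+1 - 1 @[N --> \oo] --> L - 1.
  exact: (@seq_cvgB C _ _ _ _ (@seq_cvgS C _ _ SL) (@seq_cvg_cst C 1)).
suff -> : phi (- q) = L + (L - 1).
  by rewrite (_ : L + _ = a) // /L; field.
rewrite /phi /bilateral_series; congr (_ + _); apply: (@seq_cvg_lim C).
  apply: (@eq_seq_cvg C S) => // N; apply: eq_bigr => n _.
apply: (@eq_seq_cvg C (fun N => S N.+1 - 1)) => // N.
rewrite /S big_nat_recl //= expr0 addrC addKr.
apply: eq_bigr => n _; rewrite -[RHS]/((- q) ^ (Negz n * Negz n)).
by rewrite NegzE mulrNN -PoszM -exprnP.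
Qed.

End EvaluateTheta.

(* With f = phi(-q) phi(-q^7), g = q psi(q) psi(q^7) and the cubic relation at q
   and q^2, both identities become polynomial identities in f and g. *)
Lemma eisenstein_alg (F : fieldType) (q x y x7 y7 p p7 s s7 : F) :
  x != 0 -> y != 0 -> x7 != 0 -> y7 != 0 ->
  let f := p * p7 in let g := q * s * s7 in
  f * (y * y7) = x ^+ 2 * x7 ^+ 2 ->
  g * (x * x7) = q * (y ^+ 2 * y7 ^+ 2) ->
  (f + 4 * g) ^+ 3 * (x * x7) =
    x ^+ 8 + 13 * q * x ^+ 4 * x7 ^+ 4 + 49 * q ^+ 2 * x7 ^+ 8 ->
  (f + 2 * g) ^+ 3 * (y * y7) =
    y ^+ 8 + 13 * q ^+ 2 * y ^+ 4 * y7 ^+ 4 + 49 * (q ^+ 2) ^+ 2 * y7 ^+ 8 ->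
  7 * p ^+ 3 * p7 ^+ 3 =
    - 49 * (q ^+ 2 * (x7 ^+ 7 / x) + q * x ^+ 3 * x7 ^+ 3)
    + 56 * (7 * q ^+ 4 * (y7 ^+ 7 / y) + q ^+ 2 * y ^+ 3 * y7 ^+ 3)
    - x ^+ 7 / x7 + 8 * (y ^+ 7 / y7)
  /\
  56 * q ^+ 3 * s ^+ 3 * s7 ^+ 3 =
    49 * q ^+ 2 * (x7 ^+ 7 / x) + 7 * q * x ^+ 3 * x7 ^+ 3
    - 49 * (q ^+ 4 * (y7 ^+ 7 / y) + q ^+ 2 * y ^+ 3 * y7 ^+ 3)
    + x ^+ 7 / x7 - y ^+ 7 / y7.
Proof.
move=> x0 y0 x70 y70 f g fE gE cub1 cub2.
have fE' : f = x ^+ 2 * x7 ^+ 2 / (y * y7) by rewrite -fE mulfK // mulf_neq0.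
have gE' : g = q * (y ^+ 2 * y7 ^+ 2) / (x * x7) by rewrite -gE mulfK // mulf_neq0.
have BE : f ^+ 2 * g = q * x ^+ 3 * x7 ^+ 3.
  by rewrite fE' gE'; field; rewrite x0 y0 x70 y70.
have BE2 : f * g ^+ 2 = q ^+ 2 * y ^+ 3 * y7 ^+ 3.
  by rewrite fE' gE'; field; rewrite x0 y0 x70 y70.
have AE : x ^+ 7 / x7 = (f + 4 * g) ^+ 3 - 13 * (f ^+ 2 * g)
    - 49 * q ^+ 2 * (x7 ^+ 7 / x).
  have -> : (f + 4 * g) ^+ 3 = (f + 4 * g) ^+ 3 * (x * x7) / (x * x7).
    by rewrite mulfK // mulf_neq0.
  by rewrite cub1 BE; field; rewrite x0 x70.
have AE2 : y ^+ 7 / y7 = (f + 2 * g) ^+ 3 - 13 * (f * g ^+ 2)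
    - 49 * q ^+ 4 * (y7 ^+ 7 / y).
  have -> : (f + 2 * g) ^+ 3 = (f + 2 * g) ^+ 3 * (y * y7) / (y * y7).
    by rewrite mulfK // mulf_neq0.
  by rewrite cub2 BE2; field; rewrite y0 y70.
have e1 : 7 * p ^+ 3 * p7 ^+ 3 = 7 * f ^+ 3 by rewrite /f; ring.
have e2 : 56 * q ^+ 3 * s ^+ 3 * s7 ^+ 3 = 56 * g ^+ 3 by rewrite /g; ring.
have e3 : 7 * q * x ^+ 3 * x7 ^+ 3 = 7 * (f ^+ 2 * g) by rewrite BE; ring.
(* Once x^7 / x7 and y^7 / y7 are eliminated, the remaining quotients x7^7 / x and y7^7 / y
   cancel. *)
rewrite e1 e2 e3 AE AE2 -BE -BE2; clearbody f g; split; ring.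
Qed.

(** * The cubic at points of the disc *)

Section EvaluatedCubic.
Variable R : realType.
Local Notation C := (complexField R).
Local Notation normc := (@Normc.normc R).

Lemma normcX_lt1 (q : C) k : (0 < k)%N -> normc q < 1 -> normc (q ^+ k) < 1.
Proof. by move=> k0 q1; rewrite normcX exprn_ilt1 ?normc_ge0 // -lt0n. Qed.

Lemma evaluates_dil_euler (q : C) k : (0 < k)%N -> normc q < 1 ->
  evaluates (fps_dil k (eulerS C)) q (E (q ^+ k)).
Proof.
by move=> k0 q1; apply: (evaluates_dil k0); apply: evaluates_euler; apply: normcX_lt1.
Qed.

Lemma evaluates_phi2S (q : C) : normc q < 1 ->
  evaluates (phi2S C) q (phi (- q) * phi (- q ^+ 7)).
Proof.
move=> q1; apply: evaluatesM; first exact: evaluates_phi.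
by apply: evaluates_dil => //; apply: evaluates_phi; apply: normcX_lt1.
Qed.

Lemma evaluates_psi2S (q : C) : normc q < 1 ->
  evaluates (psi2S C) q (q * psi q * psi (q ^+ 7)).
Proof.
move=> q1; apply: evaluatesM.
  by apply: evaluatesM; [exact: evaluatesX | exact: evaluates_psi].
by apply: evaluates_dil => //; apply: evaluates_psi; apply: normcX_lt1.
Qed.

Lemma evaluates_qformS (q : C) : normc q < 1 ->
  evaluates (qformS C) q
    (phi (- q) * phi (- q ^+ 7) + 4 * (q * psi q * psi (q ^+ 7))).
Proof.
move=> q1; rewrite qformSE; apply: evaluatesD; first exact: evaluates_phi2S.
by apply: evaluatesM; [exact: evaluates_nat | exact: evaluates_psi2S].
Qed.

Lemma evaluates_dil_qformS (q : C) : normc q < 1 ->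
  evaluates (fps_dil 2 (qformS C)) q
    (phi (- q) * phi (- q ^+ 7) + 2 * (q * psi q * psi (q ^+ 7))).
Proof.
move=> q1; rewrite dil_qformSE; apply: evaluatesD; first exact: evaluates_phi2S.
by apply: evaluatesM; [exact: evaluates_nat | exact: evaluates_psi2S].
Qed.

Lemma cubic_value (q x x7 z : C) : normc q < 1 ->
  evaluates (eulerS C) q x -> evaluates (fps_dil 7 (eulerS C)) q x7 ->
  evaluates (qformS C) q z ->
  z ^+ 3 * (x * x7) = x ^+ 8 + 13 * q * x ^+ 4 * x7 ^+ 4 + 49 * q ^+ 2 * x7 ^+ 8.
Proof.
move=> q1 e1 e7 ez; have eX := evaluatesX q; have en n := evaluates_nat n q.
apply: (evaluates_unique q1).
  exact: (evaluatesM (evaluates_expr 3 ez) (evaluatesM e1 e7)).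
rewrite qformS_cubic.
exact: (evaluatesD
  (evaluatesD (evaluates_expr 8 e1)
    (evaluatesM (evaluatesM (evaluatesM (en 13) eX) (evaluates_expr 4 e1))
      (evaluates_expr 4 e7)))
  (evaluatesM (evaluatesM (en 49) (evaluates_expr 2 eX)) (evaluates_expr 8 e7))).
Qed.

(** The value of z at the point q^2 is the value at q of its dilation, hence f + 2 g by uniqueness
    of evaluation. *)
Lemma cubic_dil_value (q : C) : normc q < 1 ->
  (phi (- q) * phi (- q ^+ 7) + 2 * (q * psi q * psi (q ^+ 7))) ^+ 3 *
    (E (q ^+ 2) * E (q ^+ 14)) =
  E (q ^+ 2) ^+ 8 + 13 * q ^+ 2 * E (q ^+ 2) ^+ 4 * E (q ^+ 14) ^+ 4 +
    49 * (q ^+ 2) ^+ 2 * E (q ^+ 14) ^+ 8.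
Proof.
move=> q1; have q2 := normcX_lt1 (isT : (0 < 2)%N) q1.
have [z ez] : exists z, evaluates (qformS C) (q ^+ 2) z.
  by eexists; apply: evaluates_qformS.
rewrite -(evaluates_unique q1 (evaluates_dil (isT : (0 < 2)%N) ez)
  (evaluates_dil_qformS q1)).
apply: (cubic_value q2 (evaluates_euler q2) _ ez).
have -> : q ^+ 14 = (q ^+ 2) ^+ 7 by rewrite -exprM.
exact: evaluates_dil_euler.
Qed.

End EvaluatedCubic.

Theorem theorem1p3 (R : realType) (q : R[i]) (hq : `|q| < 1) :
  7 * phi (- q) ^+ 3 * phi (- q ^+ 7) ^+ 3 =
    - 49 * (q ^+ 2 * (E (q ^+ 7) ^+ 7 / E q)
            + q * E q ^+ 3 * E (q ^+ 7) ^+ 3)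
    + 56 * (7 * q ^+ 4 * (E (q ^+ 14) ^+ 7 / E (q ^+ 2))
            + q ^+ 2 * E (q ^+ 2) ^+ 3 * E (q ^+ 14) ^+ 3)
    - E q ^+ 7 / E (q ^+ 7)
    + 8 * (E (q ^+ 2) ^+ 7 / E (q ^+ 14))
  /\
  56 * q ^+ 3 * psi q ^+ 3 * psi (q ^+ 7) ^+ 3 =
    49 * q ^+ 2 * (E (q ^+ 7) ^+ 7 / E q)
    + 7 * q * E q ^+ 3 * E (q ^+ 7) ^+ 3
    - 49 * (q ^+ 4 * (E (q ^+ 14) ^+ 7 / E (q ^+ 2))
            + q ^+ 2 * E (q ^+ 2) ^+ 3 * E (q ^+ 14) ^+ 3)
    + E q ^+ 7 / E (q ^+ 7)
    - E (q ^+ 2) ^+ 7 / E (q ^+ 14).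
Proof.
(* In [hq] the norm is a complex number; the estimates above use the real modulus. *)
have q1 : Normc.normc q < 1 by rewrite -ltcR; exact: hq.
have e k (k0 : (0 < k)%N) := evaluates_dil_euler k0 q1.
apply: (@eisenstein_alg (complexField R)).
1-4: by apply: E_neq0 => //; apply: normcX_lt1.
- apply: (evaluates_unique q1).
    exact: (evaluatesM (evaluates_phi2S q1) (evaluatesM (e 2 isT) (e 14 isT))).
  rewrite phi2S_euler.
  exact: (evaluatesM (evaluates_expr 2 (evaluates_euler q1))
                     (evaluates_expr 2 (e 7 isT))).
- apply: (evaluates_unique q1).
    exact: (evaluatesM (evaluates_psi2S q1)
                       (evaluatesM (evaluates_euler q1) (e 7 isT))).
  rewrite psi2S_euler.
  exact: (evaluatesM (evaluatesX q) (evaluatesM (evaluates_expr 2 (e 2 isT))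
                                                (evaluates_expr 2 (e 14 isT)))).
- exact: (cubic_value q1 (evaluates_euler q1) (e 7 isT) (evaluates_qformS q1)).
exact: (cubic_dil_value q1).
Qed.
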